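(* Let $X_1,\dots,X_n$ be i.i.d. from $P$ on $[0,1]^r$ with density $p$ satisfying $|p(x)-p(y)|\le L\|x-y\|$ for all $x,y$ (some constant $L>0$), and let $F$ be its cdf. Let $Z_1,\dots,Z_k$ be, given $X$, i.i.d. draws from $\hat f_{m,\delta}=(1-\delta)\hat f_m+\delta$, where $m\asymp n^{r/(6+r)}$, $k\asymp n^{4/(6+r)}$ and $\delta=mk/(n\alpha)$ (so that $\alpha$-differential privacy holds). Then $$\mathbb E\sup_{x\in[0,1]^r}|F(x)-\hat F_Z(x)|=O\Big(\frac{\sqrt{\log n}}{n^{2/(6+r)}}\Big).$$
   Context: Histogram: let $0<h<1$ be a binwidth with $m=h^{-r}$ an integer, and partition $[0,1]^r$ into $m$ cubes $B_1,\dots,B_m$ of side $h$. Let $C_j=\sum_{i=1}^n I(X_i\in B_j)$, $\hat p_j=C_j/n$, and $\hat f_m(x)=\sum_{j=1}^m (\hat p_j/h^r)I(x\in B_j)$. $\hat F_Z(t)=k^{-1}\#\{i: Z_i\le t\}$ (componentwise order) is the empirical cdf of $Z$; $F(t)=P(X\le t)$ componentwise. $\mathbb E$ is the expectation over both $X\sim P^n$ and the randomness of $Z$ given $X$. $a_n\asymp b_n$ means $a_n/b_n$ and $b_n/a_n$ are bounded for large $n$. The constant $\alpha>0$ is fixed. *)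

(* Defs.v *)
From HB Require Import structures.
From mathcomp Require Import all_boot all_order all_algebra.
From mathcomp Require Import all_classical all_reals all_analysis.
Set Implicit Arguments. Unset Strict Implicit. Unset Printing Implicit Defensive.
Import Order.TTheory GRing.Theory Num.Theory.
Import numFieldNormedType.Exports.
Local Open Scope classical_set_scope.
Local Open Scope ring_scope.

Section HistDP.
Variable R : realType.

Definition unit_cube (r : nat) : set ('I_r -> R) :=
  [set x | forall i, 0 <= x i <= 1].

Definition eucl_dist (r : nat) (x y : 'I_r -> R) : R :=
  Num.sqrt (\sum_(i < r) (x i - y i) ^+ 2).

(* Iterated Lebesgue integral over [0,1]^K of g : (nat -> R) -> \bar R,
   integrating coordinates 0, ..., K-1 (other coordinates frozen at w).
   For nonnegative measurable g this is the integral w.r.t. Lebesgue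
   measure on [0,1]^K (Tonelli). *)
Fixpoint iint_aux (K : nat) (g : (nat -> R) -> \bar R) (w : nat -> R) : \bar R :=
  match K with
  | 0 => g w
  | K'.+1 => (\int[@lebesgue_measure R]_(t in `[0%R, 1%R]%classic)
               iint_aux K' g (fun j => if j == K' then t else w j))%E
  end.

Definition iint (K : nat) (g : (nat -> R) -> \bar R) : \bar R :=
  iint_aux K g (fun _ => 0).

Definition pt (r : nat) (w : nat -> R) : 'I_r -> R := fun j => w j.
Arguments pt : clear implicits.

Definition cube_int (r : nat) (f : ('I_r -> R) -> R) : \bar R :=
  iint r (fun w => (f (pt r w))%:E).

Definition le_cw (r : nat) (x t : 'I_r -> R) : bool := [forall i, x i <= t i].

Definition cdf (r : nat) (p : ('I_r -> R) -> R) (t : 'I_r -> R) : R :=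
  fine (cube_int (fun x => if le_cw x t then p x else 0)).

(* Histogram with N bins per axis: binwidth h = 1/N, m = N^r cubes.
   Index of the bin of a coordinate u in [0,1] (u = 1 goes to the last bin). *)
Definition bin_index (N : nat) (u : R) : nat := minn (Num.truncn (u * N%:R)) N.-1.

Definition same_bin (N r : nat) (x y : 'I_r -> R) : bool :=
  [forall i, bin_index N (x i) == bin_index N (y i)].

(* \hat f_m(x) = \sum_j (\hat p_j / h^r) I(x in B_j), with \hat p_j = C_j / n,
   h^r = 1/m, m = N^r *)
Definition hist (N r n : nat) (X : 'I_n -> 'I_r -> R) (x : 'I_r -> R) : R :=
  ((#|[set i : 'I_n | same_bin N (X i) x]|)%:R / n%:R) * (N ^ r)%:R.

Definition hist_delta (N r n : nat) (delta : R) (X : 'I_n -> 'I_r -> R)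
  (x : 'I_r -> R) : R :=
  (1 - delta) * hist N X x + delta.

Definition ecdf (r k : nat) (Z : 'I_k -> 'I_r -> R) (t : 'I_r -> R) : R :=
  (#|[set l : 'I_k | le_cw (Z l) t]|)%:R / k%:R.

(* Coordinates of the joint sample inside w : nat -> R:
   X_i = (w (i*r + j))_j, Z_l = (w ((n+l)*r + j))_j. *)
Definition Xof (r n : nat) (w : nat -> R) : 'I_n -> 'I_r -> R :=
  fun i j => w (i * r + j)%N.
Arguments Xof : clear implicits.
Definition Zof (r n k : nat) (w : nat -> R) : 'I_k -> 'I_r -> R :=
  fun l j => w ((n + l) * r + j)%N.
Arguments Zof : clear implicits.

Definition ks_dev (r k : nat) (p : ('I_r -> R) -> R) (Z : 'I_k -> 'I_r -> R)
  : \bar R :=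
  ereal_sup [set (`|cdf p t - ecdf Z t|)%:E | t in @unit_cube r].

(* E sup_x |F(x) - \hat F_Z(x)|, where X_1..X_n iid with density p and,
   given X, Z_1..Z_k iid with density \hat f_{m,delta}: the integral over
   [0,1]^{(n+k) r} against the joint density
   prod_i p(X_i) * prod_l \hat f_{m,delta}(Z_l). *)
Definition expected_ks (r n k N : nat) (delta : R) (p : ('I_r -> R) -> R)
  : \bar R :=
  iint ((n + k) * r) (fun w =>
    (ks_dev p (Zof r n k w) *
     ((\prod_(i < n) p (Xof r n w i)) *
      \prod_(l < k) hist_delta N delta (Xof r n w) (Zof r n k w l))%:E)%E).

End HistDP.
Arguments expected_ks {R} r n k N delta p.

(* Main.v *)
(* Every integrand is dominated by a step function on a grid of M = N * n cells per axis, so that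
   the iterated integrals become finite sums and the i.i.d. sampling becomes a product of finite
   probability weights. Monotonicity of the integral needs no measurability, hence neither the
   density nor the supremum over t has to be shown measurable.

   On the grid the deviation splits into four parts. Given X, the empirical cdf of Z differs from
   the cdf of the privatised histogram by O(sqrt (log n / k)), by exponential moments and a union
   bound over the polynomially many grid corners; the same inequality applied to X compares the
   histogram cdf with its mean, with error O(sqrt (log n / n)). Mixing in the uniform law costs
   delta = O(n^(-2/(6+r))). Finally the mean of the histogram cdf differs from the true cdf only
   through the O(N^(r-1)) bins meeting the boundary of the orthant, where the Lipschitz density
   varies by O(1/N): a bias of O(N^-2) = O(n^(-2/(6+r))). *)

Require Import Defs.
From HB Require Import structures.
From mathcomp Require Import all_boot all_order all_algebra.
From mathcomp Require Import all_classical all_reals all_analysis.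
From mathcomp Require Import measurable_realfun.
From mathcomp Require Import zify ring lra.
Import Order.TTheory GRing.Theory Num.Theory.
Local Open Scope classical_set_scope.
Local Open Scope ring_scope.

Set Implicit Arguments.
Unset Strict Implicit.
Unset Printing Implicit Defensive.

(** * Integrals of step functions *)

Section integration.
Import HBNNSimple.
Variable R : realType.

(* The integral of a nonnegative function is by definition the supremum of the integrals of the
   simple functions below it, so monotonicity holds for arbitrary functions. *)
Lemma le_integral_nomeas d (T : measurableType d) (mu : {measure set T -> \bar R})
    (D : set T) (f g : T -> \bar R) :
  (forall x, D x -> f x <= g x)%E ->
  (\int[mu]_(x in D) f x <= \int[mu]_(x in D) g x)%E.
Proof.
move=> fg; have fgD x : ((f \_ D) x <= (g \_ D) x)%E.
  by rewrite !patchE; case: ifPn => // /set_mem; exact: fg.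
rewrite /integral; apply: leeB; apply: ereal_sup_le => _ [h /= hf <-];
  exists h => // x; apply: (le_trans (hf x)).
- by rewrite /= !funeposE ge_max !le_max fgD lexx orbT.
- by rewrite /= !funenegE ge_max !le_max leeN2 fgD lexx orbT.
Qed.

(** All coordinates are constrained, frozen ones included, which makes the condition an invariant of
    the induction on the number of integrations. *)
Definition unit_seq (w : nat -> R) := forall j, 0 <= w j <= 1.

Lemma unit_seq_upd K t w : unit_seq w -> 0 <= t <= 1 ->
  unit_seq (fun j => if j == K then t else w j).
Proof. by move=> hw ht j; case: ifP. Qed.

Lemma le_iint_aux K (f g : (nat -> R) -> \bar R) w : unit_seq w ->
  (forall v, unit_seq v -> f v <= g v)%E -> (iint_aux K f w <= iint_aux K g w)%E.
Proof.
move=> + fg; elim: K w => [|K IH] w hw /=; first exact: fg.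
apply: le_integral_nomeas => t; rewrite /= in_itv/= => ht.
by apply/IH/unit_seq_upd.
Qed.

Lemma unit_seq0 : unit_seq (fun=> 0). Proof. by move=> j; rewrite lexx ler01. Qed.

Lemma le_iint K (f g : (nat -> R) -> \bar R) :
  (forall v, unit_seq v -> f v <= g v)%E -> (iint K f <= iint K g)%E.
Proof. exact/le_iint_aux/unit_seq0. Qed.

Lemma bin_index_lt M (t : R) : (bin_index M.+1 t < M.+1)%N.
Proof. by rewrite /bin_index ltnS geq_minr. Qed.

(** The bins split the unit interval into [M.+1] pieces of length [1 / M.+1], so the integrand is a
    finite combination of their indicators. *)
Lemma integral_bin M (phi : nat -> R) : (forall j, 0 <= phi j) ->
  (\int[@lebesgue_measure R]_(t in `[0%R, 1%R]%classic) (phi (bin_index M.+1 t))%:E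
   = (M.+1%:R^-1 * \sum_(j < M.+1) phi j)%:E)%E.
Proof.
move=> phi0.
(* The last piece is closed, because [bin_index] sends the endpoint 1 to the last bin. *)
pose A (j : 'I_M.+1) : set R := if (j < M)%N then `[j%:R / M.+1%:R, j.+1%:R / M.+1%:R[%classic
  else `[j%:R / M.+1%:R, 1]%classic.
have M0 : 0 < M.+1%:R :> R by rewrite ltr0n.
have mA j : measurable (A j) by rewrite /A; case: ifP.
have A01 (j : 'I_M.+1) : A j `<=` `[0%R, 1%R]%classic.
  have h0 : 0 <= j%:R / M.+1%:R :> R by rewrite divr_ge0.
  have h1 : j.+1%:R / M.+1%:R <= 1 :> R by rewrite ler_pdivrMr// mul1r ler_nat.
  rewrite /A; case: ifP => _ t; rewrite /= !in_itv/= => /andP[a b]; apply/andP; split=> //;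
    by [exact: le_trans a|exact: le_trans (ltW b) h1].
have muA j : lebesgue_measure (A j) = (M.+1%:R^-1)%:E :> \bar R.
  rewrite /A; case: ltnP => jM; rewrite lebesgue_measure_itv/= lte_fin.
    rewrite ltr_pM2r ?invr_gt0// ltr_nat ltnSn -EFinD -mulrBl.
    by rewrite -[in j.+1%:R]addn1 natrD addrAC subrr add0r mul1r.
  have -> : (j : nat) = M by apply/eqP; rewrite eqn_leq jM -ltnS ltn_ord.
  rewrite ltr_pdivrMr// mul1r ltr_nat ltnSn -EFinD; congr EFin.
  by rewrite -natr1; field; rewrite natr1 pnatr_eq0.
have binA t : `[0%R, 1%R]%classic t -> forall j : 'I_M.+1, (t \in A j) = (bin_index M.+1 t == j).
  rewrite /= in_itv/= => /andP[t0 t1] j.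
  have tM0 : 0 <= t * M.+1%:R by rewrite mulr_ge0.
  rewrite /bin_index /A; case: ltnP => jM; apply/idP/idP.
  - rewrite inE/= in_itv/= ler_pdivrMr// ltr_pdivlMr// => jt.
    by rewrite (truncn_def jt) /= (minn_idPl _)// ltnW.
  - move=> /eqP; rewrite /= => jj.
    have minE (q : nat) : minn q M = j -> q == j by move=> ?; apply/eqP; lia.
    move: (minE _ jj).
    by rewrite truncn_eq// inE/= in_itv/= ler_pdivrMr// ltr_pdivlMr.
  - have -> : (j : nat) = M by apply/eqP; rewrite eqn_leq jM -ltnS ltn_ord.
    rewrite inE/= in_itv/= ler_pdivrMr// => /andP[jt _].
    by apply/eqP/minn_idPr; rewrite truncn_ge_nat.
  - have -> : (j : nat) = M by apply/eqP; rewrite eqn_leq jM -ltnS ltn_ord.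
    move=> /eqP/minn_idPr/=; rewrite truncn_ge_nat// => jt.
    by rewrite inE/= in_itv/= ler_pdivrMr// jt.
transitivity (\int[@lebesgue_measure R]_(t in `[0%R, 1%R]%classic)
    \sum_(j < M.+1) ((phi j)%:E * (\1_(A j) t)%:E))%E.
  apply: eq_integral => t /set_mem t01.
  rewrite (bigD1 (Ordinal (bin_index_lt M t)))//= big1.
    by rewrite adde0 indicE binA// eqxx/= mule1.
  move=> j jt; rewrite indicE binA//.
  case: eqP => [e|]; last by rewrite mule0.
  by case/eqP: jt; apply: val_inj.
rewrite ge0_integral_sum//; last 2 first.
- move=> j; apply: measurable_funeM; apply/measurable_EFinP.
  apply: measurable_indic; exact: mA.
- by move=> j t _; apply: mule_ge0; rewrite lee_fin// indicE.
rewrite big_distrr/= -sumEFin; apply: eq_bigr => j _.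
rewrite ge0_integralZl_EFin//; last first.
  by apply/measurable_EFinP; apply: measurable_indic; exact: mA.
have -> : (\int[@lebesgue_measure R]_(x in `[0%R, 1%R]%classic) (\1_(A j) x)%:E =
    (M.+1%:R^-1)%:E)%E.
  rewrite -(muA j) integral_indic; [|by []|exact: mA].
  by congr (lebesgue_measure _); exact: (setIidl (A01 j)).
by rewrite -EFinM mulrC.
Qed.

Definition ffun_ext M K (c : {ffun 'I_K -> 'I_M}) (v : nat -> nat) : nat -> nat :=
  fun j => if (insub j : option 'I_K) is Some i then (c i : nat) else v j.

(** The appended entry is coordinate [K], the variable of the outermost integral in
    [iint_aux K.+1]. *)
Definition ffun_rcons M K (cj : {ffun 'I_K -> 'I_M} * 'I_M) :
    {ffun 'I_K.+1 -> 'I_M} :=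
  [ffun i => if unlift ord_max i is Some i' then cj.1 i' else cj.2].

Lemma ffun_rcons_bij M K : bijective (@ffun_rcons M K).
Proof.
exists (fun c : {ffun 'I_K.+1 -> 'I_M} =>
  ([ffun i : 'I_K => c (lift ord_max i)], c ord_max)) => [[c j]|c].
  rewrite /ffun_rcons ffunE unlift_none/=; congr (_, _).
  by apply/ffunP => i; rewrite !ffunE liftK.
apply/ffunP => i; rewrite ffunE; case: unliftP => [i' ->|->] //=.
by rewrite ffunE.
Qed.

Lemma ffun_ext_rcons M K (c : {ffun 'I_K -> 'I_M}) (j : 'I_M) v :
  ffun_ext (ffun_rcons (c, j)) v = ffun_ext c (fun i => if i == K then (j : nat) else v i).
Proof.
apply/funext => i; rewrite /ffun_ext; case: insubP => [i' iK <-|].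
  rewrite ffunE; case: unliftP => [i''|] -> /=.
    rewrite /bump leqNgt ltn_ord add0n.
    by case: insubP => [i3 _ /val_inj ->//|]; rewrite ltn_ord.
  by case: insubP => [i3|]; rewrite ?ltnn// eqxx.
rewrite -leqNgt => iK; case: insubP => [i' i'K|_]; last by case: ltngtP iK.
by move: i'K; lia.
Qed.

(** Induction on [K]: the inner integrals are a grid sum by hypothesis, [integral_bin] evaluates the
    outermost one, and [ffun_rcons] merges the two sums. *)
Lemma iint_aux_bin M K (G : (nat -> nat) -> R) w : (forall v, 0 <= G v) ->
  iint_aux K (fun v => (G (fun j => bin_index M.+1 (v j)))%:E) w =
  (M.+1%:R ^- K * \sum_(c : {ffun 'I_K -> 'I_M.+1})
     G (ffun_ext c (fun j => bin_index M.+1 (w j))))%:E.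
Proof.
move=> G0; elim: K w => [|K IH] w.
  have -> : iint_aux 0 (fun v => (G (fun j => bin_index M.+1 (v j)))%:E) w =
    (G (fun j => bin_index M.+1 (w j)))%:E by [].
  rewrite expr0 invr1 mul1r (big_pred1 [ffun i => ord0]); last first.
    by move=> c; apply/esym/eqP/ffunP; case.
  congr (G _)%:E; apply/funext => j; rewrite /ffun_ext.
  by case: insubP => // -[].
transitivity (\int[@lebesgue_measure R]_(t in `[0%R, 1%R]%classic)
   (M.+1%:R ^- K * \sum_(c : {ffun 'I_K -> 'I_M.+1})
     G (ffun_ext c (fun j => if j == K then bin_index M.+1 t else bin_index M.+1 (w j))))%:E)%E.
  apply: eq_integral => t _; apply: etrans (IH _) _; congr (_ * _)%:E.
  apply: eq_bigr => c _; congr (G (ffun_ext _ _)).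
  by apply/funext => j; case: ifP.
rewrite (integral_bin M (phi := fun b => M.+1%:R ^- K * \sum_(c : {ffun 'I_K -> 'I_M.+1})
     G (ffun_ext c (fun j => if j == K then b else bin_index M.+1 (w j))))); last first.
  by move=> b; rewrite mulr_ge0 ?invr_ge0 ?exprn_ge0 ?sumr_ge0.
rewrite -big_distrr/= mulrA -invfM -exprS; congr (_ * _)%:E.
rewrite exchange_big pair_big/= (reindex (@ffun_rcons _ K)) /=; last first.
  exact/onW_bij/ffun_rcons_bij.
by apply: eq_bigr => -[c j] _; rewrite ffun_ext_rcons.
Qed.

Lemma iint_bin M K (G : (nat -> nat) -> R) : (forall v, 0 <= G v) ->
  iint K (fun v => (G (fun j => bin_index M.+1 (v j)))%:E) =
  (M.+1%:R ^- K * \sum_(c : {ffun 'I_K -> 'I_M.+1}) G (ffun_ext c (fun=> 0%N)))%:E.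
Proof.
move=> G0; rewrite /iint iint_aux_bin//; congr (_ * _)%:E.
apply: eq_bigr => c _; congr (G (ffun_ext _ _)); apply/funext => j.
by rewrite /bin_index mul0r truncn0 min0n.
Qed.

Definition cell r M (v : nat -> nat) : {ffun 'I_r -> 'I_M.+1} := [ffun j => inord (v (j : 'I_r))].

Lemma iint_cell r M (G : {ffun 'I_r -> 'I_M.+1} -> R) : (forall c, 0 <= G c) ->
  iint r (fun v => (G (cell r M (fun j => bin_index M.+1 (v j))))%:E) =
  (M.+1%:R ^- r * \sum_c G c)%:E.
Proof.
move=> G0; rewrite (@iint_bin M r (fun v => G (cell r M v)))//; congr (_ * _)%:E.
apply: eq_bigr => c _; congr G; apply/ffunP => i; rewrite ffunE /ffun_ext.
case: insubP => [i' _ /val_inj ->|]; last by rewrite ltn_ord.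
exact: inord_val.
Qed.

(** The layout of [Xof] and [Zof] read on cells: observations first, synthetic points after. *)
Definition blocks r M n k (v : nat -> nat) :
    {ffun 'I_n -> {ffun 'I_r -> 'I_M.+1}} * {ffun 'I_k -> {ffun 'I_r -> 'I_M.+1}} :=
  ([ffun i : 'I_n => cell r M (fun j => v (i * r + j)%N)],
   [ffun l : 'I_k => cell r M (fun j => v ((n + l) * r + j)%N)]).

(** The two types have equal cardinality, so injectivity suffices; quotient and remainder by [r]
    locate each flat index in its block. *)
Lemma blocks_bij r M n k : bijective
  (fun c : {ffun 'I_((n + k) * r) -> 'I_M.+1} => blocks r M n k (ffun_ext c (fun=> 0%N))).
Proof.
apply: inj_card_bij; last first.
  rewrite card_prod !card_ffun !card_ord -!expnM -expnD.
  by rewrite -mulnDr mulnC.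
move=> c c' [/ffunP e1 /ffunP e2]; apply/ffunP => i.
have r0 : (0 < r)%N.
  by have := leq_ltn_trans (leq0n i) (ltn_ord i); rewrite muln_gt0 => /andP[].
have ij : (i %% r < r)%N by rewrite ltn_mod.
have ib : (i %/ r < n + k)%N by rewrite ltn_divLR.
have key : forall b, b = (i %/ r)%N -> cell r M (fun j => ffun_ext c (fun=> 0%N) (b * r + j)%N) =
    cell r M (fun j => ffun_ext c' (fun=> 0%N) (b * r + j)%N) -> c i = c' i.
  move=> b -> /ffunP /(_ (Ordinal ij)); rewrite !ffunE/= -divn_eq /ffun_ext.
  case: insubP => [i' _ /val_inj ->|]; last by rewrite ltn_ord.
  by rewrite !inord_val.
have [lt|le] := ltnP (i %/ r) n.
  by apply: (key _ erefl); have := e1 (Ordinal lt); rewrite !ffunE.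
have lk : (i %/ r - n < k)%N by rewrite ltn_subLR.
by apply: (key _ (subnKC le)); have := e2 (Ordinal lk); rewrite !ffunE.
Qed.

Lemma iint_blocks r M n k (G : {ffun 'I_n -> {ffun 'I_r -> 'I_M.+1}} ->
    {ffun 'I_k -> {ffun 'I_r -> 'I_M.+1}} -> R) : (forall x z, 0 <= G x z) ->
  iint ((n + k) * r) (fun v =>
    let b := blocks r M n k (fun j => bin_index M.+1 (v j)) in (G b.1 b.2)%:E) =
  (M.+1%:R ^- ((n + k) * r) * \sum_x \sum_z G x z)%:E.
Proof.
move=> G0; rewrite (@iint_bin M _ (fun v => G (blocks r M n k v).1 (blocks r M n k v).2))//.
congr (_ * _)%:E; rewrite pair_big/=; apply/esym.
rewrite (reindex _ (onW_bij _ (blocks_bij r M n k))) /=.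
by [].
Qed.
End integration.

(** * A maximal inequality for empirical means *)

Section concentration.
Variable R : realType.

(** Since $e^{-x} \ge 1-x$, it suffices that $(1-x)(1+x+2x^2) = 1 + x^2(1-2x) \ge 1$. *)
Lemma expR_le_quadratic (x : R) : x <= 2^-1 -> expR x <= 1 + x + 2 * x ^+ 2.
Proof.
move=> x2; have h1 : 0 < 1 - x by lra.
have h2 : expR x <= (1 - x)^-1.
  rewrite -[x in expR x]opprK expRN lef_pV2 ?posrE ?expR_gt0//.
  exact: expR_ge1Dx.
apply: (le_trans h2); rewrite -(ler_pM2r h1) mulVf ?gt_eqF//; nra.
Qed.

(** In the quadratic bound the linear term averages to zero, which leaves $1+2\lambda^2 \le
    e^{2\lambda^2}$. *)
Lemma expR_centered_le (T : finType) (w g : T -> R) (mu lam : R) :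
  (forall t, 0 <= w t) -> \sum_t w t = 1 -> \sum_t w t * g t = mu ->
  (forall t, `|g t - mu| <= 1) -> 0 <= lam <= 2^-1 ->
  \sum_t w t * expR (lam * (g t - mu)) <= expR (2 * lam ^+ 2).
Proof.
move=> w0 w1 wg gb /andP[l0 l2].
apply: (@le_trans _ _ (\sum_t w t * (1 + lam * (g t - mu) + 2 * lam ^+ 2))).
  apply: ler_sum => t _; apply: ler_wpM2l => //.
  have := gb t; rewrite ler_norml => /andP[g1 g2].
  have h : lam * (g t - mu) <= 2^-1 by nra.
  apply: (le_trans (expR_le_quadratic h)).
  have : (g t - mu) ^+ 2 <= 1 by nra.
  rewrite exprMn => hh; have : lam ^+ 2 * (g t - mu) ^+ 2 <= lam ^+ 2 by nra.
  lra.
rewrite (eq_bigr (fun t =>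
   lam * (w t * g t) + (1 - lam * mu + 2 * lam ^+ 2) * w t)); last by move=> t _; ring.
rewrite big_split/= -!big_distrr/= wg w1.
have := expR_ge1Dx (2 * lam ^+ 2); lra.
Qed.

Lemma sum_prod_expR (T : finType) (k : nat) (w h : T -> R) :
  \sum_(x : {ffun 'I_k -> T}) (\prod_i w (x i)) * expR (\sum_i h (x i)) =
  (\sum_t w t * expR (h t)) ^+ k.
Proof.
transitivity (\prod_(i < k) \sum_t w t * expR (h t)); last first.
  by rewrite prodr_const card_ord.
rewrite (bigA_distr_bigA (fun _ t => w t * expR (h t)))/=.
by apply: eq_bigr => x _; rewrite big_split/= expR_sum.
Qed.

Lemma sum_prod_eq1 (T : finType) (k : nat) (w : T -> R) :
  \sum_t w t = 1 -> \sum_(x : {ffun 'I_k -> T}) \prod_i w (x i) = 1.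
Proof.
move=> w1; rewrite -(bigA_distr_bigA (fun _ t => w t))/= w1.
by rewrite big1.
Qed.

(** When [g] consists of indicators of orthants, this is the sup distance between the empirical cdf
    of [x] and the cdf of [w]. *)
Definition max_dev (S T : finType) (k : nat) (w : T -> R) (g : S -> T -> R)
    (x : 'I_k -> T) : R :=
  \big[Num.max/0]_s `|(\sum_i g s (x i)) / k%:R - \sum_t w t * g s t|.

Lemma max_dev_ge (S T : finType) (k : nat) (w : T -> R) (g : S -> T -> R)
    (x : 'I_k -> T) s :
  `|(\sum_i g s (x i)) / k%:R - \sum_t w t * g s t| <= max_dev w g x.
Proof. exact: (le_bigmax 0 (fun s => `|(\sum_i g s (x i)) / k%:R - \sum_t w t * g s t|)). Qed.

Section bounded.
Variables (S T : finType) (k : nat) (w : T -> R) (g : S -> T -> R).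
Hypotheses (k0 : (0 < k)%N) (w0 : forall t, 0 <= w t) (w1 : \sum_t w t = 1).
Hypothesis g01 : forall s t, 0 <= g s t <= 1.

Let mu s := \sum_t w t * g s t.

Let mu01 s : 0 <= mu s <= 1.
Proof.
apply/andP; split; first by apply: sumr_ge0 => t _; have := g01 s t; have := w0 t; nra.
rewrite -w1; apply: ler_sum => t _; have := g01 s t; have := w0 t; nra.
Qed.

Let dev_sum s (x : 'I_k -> T) :
  (\sum_i g s (x i)) / k%:R - mu s = (\sum_i (g s (x i) - mu s)) / k%:R.
Proof.
rewrite sumrB sumr_const card_ord -[mu s *+ k]mulr_natr mulrBl mulfK//.
by rewrite pnatr_eq0 -lt0n.
Qed.

(** The sign [sg] treats both tails at once; independence splits the moment generating function into
    [k] equal factors. *)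
Let dev_mgf s (lam : R) (sg : bool) : 0 <= lam <= 2^-1 ->
  \sum_(x : {ffun 'I_k -> T}) (\prod_i w (x i)) *
     expR (lam * k%:R * ((-1) ^+ sg * ((\sum_i g s (x i)) / k%:R - mu s)))
  <= expR (2 * k%:R * lam ^+ 2).
Proof.
move=> lamb; have kR : k%:R != 0 :> R by rewrite pnatr_eq0 -lt0n.
rewrite (eq_bigr (fun x : {ffun 'I_k -> T} => (\prod_i w (x i)) *
    expR (\sum_i lam * ((-1) ^+ sg * g s (x i) - (-1) ^+ sg * mu s)))); last first.
  move=> x _; congr (_ * expR _).
  under [RHS]eq_bigr do rewrite -mulrBr mulrA.
  by rewrite dev_sum -big_distrr/=; field.
rewrite (sum_prod_expR _ _ (fun t => lam * ((-1) ^+ sg * g s t - (-1) ^+ sg * mu s))).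
rewrite (_ : 2 * _ * _ = (2 * lam ^+ 2) * k%:R); last by ring.
rewrite expRM_natr; apply: lerXn2r; rewrite ?nnegrE ?expR_ge0//.
  by apply: sumr_ge0 => t _; rewrite mulr_ge0 ?expR_ge0.
apply: expR_centered_le => //.
  by under eq_bigr do rewrite mulrCA; rewrite -big_distrr.
move=> t; rewrite -mulrBr normrM normrX normrN1 expr1n mul1r.
have := mu01 s; have := g01 s t; rewrite ler_norml; lra.
Qed.

Lemma max_dev_le1 (x : 'I_k -> T) : max_dev w g x <= 1.
Proof.
apply: bigmax_le => // s _; rewrite -/(mu s).
have := mu01 s; have : 0 <= (\sum_i g s (x i)) / k%:R <= 1.
  rewrite divr_ge0 ?sumr_ge0//=; last by move=> i _; case/andP: (g01 s (x i)).
  rewrite ler_pdivrMr ?ltr0n// mul1r -[in leRHS](card_ord k) -sumr_const.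
  by apply: ler_sum => i _; case/andP: (g01 s (x i)).
rewrite ler_norml; lra.
Qed.

(** Apply $y \le e^y$ to $y = \lambda k(|d| - a)$. As [|d|] is one of the two signed deviations, the
    sum over all [s] and signs dominates: a union bound in expectation, with no tail integral. *)
Let max_dev_expR (lam a : R) (x : 'I_k -> T) : 0 < lam -> 0 <= a ->
  max_dev w g x <= a + (lam * k%:R)^-1 * expR (- (lam * k%:R * a)) *
    \sum_s \sum_(sg : bool)
      expR (lam * k%:R * ((-1) ^+ sg * ((\sum_i g s (x i)) / k%:R - mu s))).
Proof.
move=> lam0 a0; have kR : 0 < k%:R :> R by rewrite ltr0n.
have lk : 0 < lam * k%:R by rewrite mulr_gt0.
have E0 (sg : bool) s : 0 <= expR (lam * k%:R * ((-1) ^+ sg * ((\sum_i g s (x i)) / k%:R - mu s))).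
  exact: expR_ge0.
apply: bigmax_le => [|s _].
  apply: addr_ge0 => //; apply: mulr_ge0.
    by rewrite mulr_ge0 ?expR_ge0 ?invr_ge0 ?ltW.
  by apply: sumr_ge0 => s _; apply: sumr_ge0.
rewrite -/(mu s); set d := _ - mu s.
have -> : `|d| = (-1) ^+ (d < 0)%R * d by rewrite normrEsign.
set e := _ * d.
have h1 : lam * k%:R * (e - a) <= expR (lam * k%:R * (e - a)).
  have := expR_ge1Dx (lam * k%:R * (e - a)); lra.
have {h1} : e - a <= (lam * k%:R)^-1 * expR (lam * k%:R * (e - a)).
  by rewrite ler_pdivlMl.
rewrite mulrBr expRD => h2; rewrite -lerBlDl; apply: (le_trans h2).
rewrite -mulrA ler_pM2l ?invr_gt0// mulrC ler_pM2l ?expR_gt0//.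
rewrite (bigD1 s)//= (bigD1 (d < 0)%R)//= -addrA lerDl.
by apply: addr_ge0; apply: sumr_ge0 => // *; apply: sumr_ge0.
Qed.

Lemma expected_max_dev_mgf (lam a : R) : 0 < lam <= 2^-1 -> 0 <= a ->
  \sum_(x : {ffun 'I_k -> T}) (\prod_i w (x i)) * max_dev w g x <=
  a + (lam * k%:R)^-1 * expR (- (lam * k%:R * a)) *
    (2 * #|S|%:R * expR (2 * k%:R * lam ^+ 2)).
Proof.
move=> /andP[lam0 lam2] a0.
have lk : 0 < lam * k%:R by rewrite mulr_gt0// ltr0n.
set c := (lam * k%:R)^-1 * _.
have c0 : 0 <= c by rewrite mulr_ge0 ?expR_ge0 ?invr_ge0 ?ltW.
apply: (@le_trans _ _ (\sum_(x : {ffun 'I_k -> T}) (\prod_i w (x i)) *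
  (a + c * \sum_s \sum_(sg : bool)
      expR (lam * k%:R * ((-1) ^+ sg * ((\sum_i g s (x i)) / k%:R - mu s)))))).
  apply: ler_sum => x _; apply: ler_wpM2l; first exact: prodr_ge0.
  exact: max_dev_expR.
under eq_bigr => x _ do rewrite mulrDr [X in _ + X]mulrCA.
rewrite big_split/= -big_distrl/= sum_prod_eq1// mul1r lerD2l.
rewrite -big_distrr/= ler_wpM2l//.
under eq_bigr => x _.
  rewrite big_distrr/=; under eq_bigr => s _ do rewrite big_distrr/=.
  over.
rewrite exchange_big/=; under eq_bigr => s _ do rewrite exchange_big/=.
apply: (@le_trans _ _ (\sum_(s : S) \sum_(sg : bool) expR (2 * k%:R * lam ^+ 2))).
  apply: ler_sum => s _; apply: ler_sum => sg _; apply: dev_mgf.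
  by rewrite (ltW lam0).
rewrite !sumr_const card_bool -[X in X <= _]mulr_natr -mulr_natr.
by rewrite le_eqVlt; apply/orP; left; apply/eqP; ring.
Qed.

(* The choice lam = sqrt (l / k), a = (B + 2) lam makes the union bound over S harmless; when
   lam > 1/2 the claim is trivial because max_dev <= 1. *)
Lemma expected_max_dev (B l : R) : 0 <= B -> 1 <= l -> #|S|%:R <= expR (B * l) ->
  \sum_(x : {ffun 'I_k -> T}) (\prod_i w (x i)) * max_dev w g x <=
  (B + 4) * Num.sqrt (l / k%:R).
Proof.
move=> B0 l1 SB; have kR : 0 < k%:R :> R by rewrite ltr0n.
set lam := Num.sqrt _.
have lam0 : 0 < lam by rewrite sqrtr_gt0 divr_gt0//; lra.
have lam2 : k%:R * lam ^+ 2 = l.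
  rewrite sqr_sqrtr ?divr_ge0//; [by field; rewrite gt_eqF|lra].
have [lamb|lamb] := lerP lam 2^-1; last first.
  apply: (@le_trans _ _ 1); last by nra.
  rewrite -[leRHS](sum_prod_eq1 k w1); apply: ler_sum => x _.
  by rewrite -[leRHS]mulr1; apply: ler_wpM2l; [exact: prodr_ge0|exact: max_dev_le1].
apply: le_trans (@expected_max_dev_mgf lam ((B + 2) * lam) _ _) _.
- by rewrite lam0.
- by rewrite mulr_ge0 ?ltW//; lra.
rewrite (_ : lam * _ * _ = (B + 2) * l); last by rewrite -lam2; ring.
rewrite (_ : 2 * k%:R * _ = 2 * l); last by rewrite -lam2; ring.
(* The exponents [-(B + 2) l], [B l] and [2 l] cancel; the remaining 2 counts the signs. *)
have : expR (- ((B + 2) * l)) * (2 * #|S|%:R * expR (2 * l)) <= 2.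
  apply: (@le_trans _ _ (expR (- ((B + 2) * l)) * (2 * expR (B * l) * expR (2 * l)))).
    by rewrite ler_pM2l ?expR_gt0// ler_pM2r ?expR_gt0// ler_pM2l.
  rewrite mulrC -!mulrA -!expRD (_ : _ + _ = 0) ?expR0 ?mulr1//; ring.
set e := expR _ * _ => e2.
rewrite -mulrA -/e.
suff : (lam * k%:R)^-1 * e <= 2 * lam by lra.
rewrite ler_pdivrMl ?mulr_gt0//.
suff : lam * k%:R * (2 * lam) = 2 * l by lra.
by rewrite -lam2; ring.
Qed.
End bounded.
End concentration.

(** * Bias of the block average on the grid *)

Section cells.
Variable R : realType.

Lemma natr_forall (I : finType) (P : pred I) :
  ([forall i, P i])%:R = \prod_i (P i)%:R :> R.
Proof.
case: forallP => [h|/forallP]; first by rewrite big1// => i _; rewrite h.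
by rewrite negb_forall => /existsP[i /negbTE Pi]; rewrite (bigD1 i)//= Pi mul0r.
Qed.

Lemma sum_ffun_prod (I J : finType) (F : I -> J -> R) :
  \sum_(c : {ffun I -> J}) \prod_i F i (c i) = \prod_i \sum_u F i u.
Proof. by rewrite bigA_distr_bigA. Qed.

(** The other [r - 1] coordinates are free; their number of choices is written as a quotient, so
    that no truncated subtraction occurs. *)
Lemma sum_ffun_coord r (U : finType) (j : 'I_r) (P : pred U) : (0 < #|U|)%N ->
  \sum_(c : {ffun 'I_r -> U}) (P (c j))%:R =
  #|U|%:R ^+ r / #|U|%:R * \sum_u (P u)%:R :> R.
Proof.
move=> U0; have Un0 : #|U|%:R != 0 :> R by rewrite pnatr_eq0 -lt0n.
have -> : \sum_(c : {ffun 'I_r -> U}) (P (c j))%:R =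
    \sum_(c : {ffun 'I_r -> U}) \prod_i (if i == j then (P (c i))%:R else 1) :> R.
  apply: eq_bigr => c _; rewrite (bigD1 j)//= eqxx big1 ?mulr1// => i /negbTE -> //.
rewrite (sum_ffun_prod (fun i u => if i == j then (P u)%:R else 1)) (bigD1 j)//= eqxx mulrC.
congr (_ * _); rewrite (eq_bigr (fun=> #|U|%:R)); last first.
  by move=> i /negbTE ->; rewrite sumr_const.
rewrite prodr_const cardC1 card_ord.
by case: r j => [[]//|r j]; rewrite exprSr mulfK.
Qed.

Lemma sum_block N J v : (0 < J)%N ->
  (\sum_(0 <= u < N * J) (u %/ J == v) = J * (v < N))%N.
Proof.
move=> J0; elim: N => [|N IH]; first by rewrite mul0n big_geq// muln0.
rewrite (@big_cat_nat _ _ _ (N * J))//=; last by rewrite leq_mul2r leqnSn orbT.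
rewrite IH (@eq_big_nat _ _ _ _ _ _ (fun=> (N == v) : nat)); last first.
  move=> i /andP[h1 h2]; rewrite (_ : (i %/ J)%N = N)//.
  by apply/eqP; rewrite eqn_leq leq_divRL// h1 andbT -ltnS ltn_divLR.
rewrite sum_nat_const_nat -mulnBl subSnn mul1n -mulnDr; congr (_ * _)%N.
by rewrite ltnS; case: ltngtP.
Qed.

Section grid.
Variables (r M N J : nat).
Hypotheses (NJ : M.+1 = (N * J)%N).
Local Notation cells := {ffun 'I_r -> 'I_M.+1}.
Local Notation corners := {ffun 'I_r -> 'I_M.+2}.

Lemma blocks_gt0 : (0 < N)%N /\ (0 < J)%N.
Proof. by have := ltn0Sn M; rewrite NJ muln_gt0 => /andP. Qed.

(** A corner takes [M.+2] values per axis, one more than a cell, as an orthant may contain no layer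
    of cells or all of them. *)
Definition below (s : corners) (c : cells) : bool := [forall i, (c i < s i)%N].

(** Histogram bins on the fine grid: each of the [N] bins per axis is a run of [J] consecutive
    cells. *)
Definition same_block (c c' : cells) : bool := [forall i, (c i %/ J == c' i %/ J)%N].

Lemma same_block_sym c c' : same_block c c' = same_block c' c.
Proof. by apply: eq_forallb => i; rewrite eq_sym. Qed.

Lemma sum_block_ord v : \sum_(u < M.+1) (u %/ J == v)%N%:R = (J * (v < N))%:R :> R.
Proof.
have [N0 J0] := blocks_gt0.
by rewrite -(sum_block N v J0) -NJ big_mkord natr_sum.
Qed.

Lemma sum_same_block c : \sum_c' (same_block c c')%:R = J%:R ^+ r :> R.
Proof.
have [N0 J0] := blocks_gt0.
under eq_bigr => c' _ do rewrite natr_forall.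
rewrite (sum_ffun_prod (fun i (u : 'I_M.+1) => (c i %/ J == u %/ J)%N%:R)).
rewrite (eq_bigr (fun=> J%:R)); first by rewrite prodr_const card_ord.
move=> i _; under eq_bigr => u _ do rewrite eq_sym.
rewrite sum_block_ord (_ : (_ < _)%N = true) ?muln1//.
by rewrite ltn_divLR// -NJ ltn_ord.
Qed.

Lemma sum_cells_le (P : 'I_r -> pred 'I_M.+1) (m : R) :
  (forall j, \sum_u (P j u)%:R <= m) ->
  \sum_(c : cells) \sum_j (P j (c j))%:R <= M.+1%:R ^+ r * (r%:R * (m / M.+1%:R)).
Proof.
move=> Pm; rewrite exchange_big/= mulrCA mulr_natl.
rewrite -[r in _ *+ r](card_ord r) -sumr_const; apply: ler_sum => j _.
rewrite sum_ffun_coord card_ord// -mulrA ler_wpM2l ?exprn_ge0//.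
by rewrite mulrC ler_wpM2r ?invr_ge0.
Qed.

Lemma ltn_same_block c c' s : (c %/ J)%N = (c' %/ J)%N -> (c %/ J)%N <> (s %/ J)%N ->
  (c < s)%N = (c' < s)%N.
Proof.
move=> e ne; apply/idP/idP => [cs|cs']; rewrite ltnNge; apply/negP => h; apply: ne.
  by apply/anti_leq; rewrite (leq_div2r J (ltnW cs))/= e (leq_div2r J h).
by apply/anti_leq; rewrite (leq_div2r J h) e (leq_div2r J (ltnW cs')).
Qed.

(** An orthant separates two cells of one block only if, on some axis, the block contains the
    coordinate [s j] of a face; the sum counts such axes. *)
Lemma below_same_block s c c' : same_block c c' ->
  `|(below s c')%:R - (below s c)%:R| <= \sum_j (c j %/ J == s j %/ J)%N%:R :> R.
Proof.
move=> /forallP cc'; case: (boolP [exists j, (c j %/ J == s j %/ J)%N]) => [/existsP[j js]|].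
  rewrite (bigD1 j)//= js; apply: (@le_trans _ _ 1).
    by case: below; case: below; rewrite ?subrr ?subr0 ?sub0r ?normrN ?normr1 ?normr0.
  by rewrite lerDl sumr_ge0.
rewrite negb_exists => /forallP h.
rewrite (_ : below s c' = below s c) ?subrr ?normr0 ?sumr_ge0//.
apply: eq_forallb => i; apply/esym/ltn_same_block; first exact/eqP.
exact/eqP.
Qed.

(* Symmetrising the double sum in (c, c') turns the value of pi into a difference of values
   over one block, while only the blocks meeting the boundary of [0,s) contribute:
   this is what makes the bias quadratic in the binwidth. *)
Lemma block_average_bias (pi : cells -> R) (D : R) (s : corners) :
  0 <= D -> (forall c c', same_block c c' -> `|pi c - pi c'| <= D) ->
  `|\sum_c pi c * (J%:R ^- r * \sum_c' (same_block c c')%:R * (below s c')%:R)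
    - \sum_c pi c * (below s c)%:R| <= M.+1%:R ^+ r * D * (r%:R / N%:R).
Proof.
move=> D0 piD; have [N0 J0] := blocks_gt0.
have Jr0 : J%:R ^+ r != 0 :> R by rewrite expf_neq0// pnatr_eq0 -lt0n.
set A := (X in `|X|).
pose S := \sum_c \sum_c' (same_block c c')%:R * (pi c * ((below s c')%:R - (below s c)%:R)) : R.
have AS : A = J%:R ^- r * S.
  rewrite /A -sumrB /S big_distrr/=; apply: eq_bigr => c _.
  rewrite [in RHS](eq_bigr (fun c' => pi c * ((same_block c c')%:R * (below s c')%:R)
       - (pi c * (below s c)%:R) * (same_block c c')%:R)); last by move=> *; ring.
  rewrite sumrB -!big_distrr/= sum_same_block; by field.
have S2 : 2 * S = \sum_c \sum_c' (same_block c c')%:R *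
    ((pi c - pi c') * ((below s c')%:R - (below s c)%:R)).
  have S' : S = \sum_c \sum_c' (same_block c' c)%:R *
      (pi c' * ((below s c)%:R - (below s c')%:R)) by rewrite /S exchange_big.
  transitivity (S + \sum_c \sum_c' (same_block c' c)%:R *
      (pi c' * ((below s c)%:R - (below s c')%:R))); first by (rewrite -S'; ring).
  rewrite /S -big_split/=; apply: eq_bigr => c _.
  rewrite -big_split/=; apply: eq_bigr => c' _; rewrite (same_block_sym c' c). ring.
have S2b : `|2 * S| <= J%:R ^+ r * (D * (M.+1%:R ^+ r * (r%:R / N%:R))).
  rewrite S2; apply: (@le_trans _ _ (\sum_c \sum_c' (same_block c c')%:R * (D *
      \sum_j (c j %/ J == s j %/ J)%N%:R))).
    apply: (le_trans (ler_norm_sum _ _ _)); apply: ler_sum => c _.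
    apply: (le_trans (ler_norm_sum _ _ _)); apply: ler_sum => c' _.
    rewrite normrM ger0_norm//; case: (boolP (same_block c c')) => cc'; rewrite ?mul0r// !mul1r.
    by rewrite normrM ler_pM// ?piD// below_same_block.
  under eq_bigr => c _ do rewrite -big_distrl/= sum_same_block.
  rewrite -!big_distrr/= ler_wpM2l ?exprn_ge0// ler_wpM2l//.
  apply: le_trans (sum_cells_le (P := fun j u => (u %/ J == s j %/ J)%N) (m := J%:R) _) _.
    (* The corner coordinate [s j = M.+1] has quotient [N], which is no block: the sum is then 0
       instead of [J]. *)
    by move=> j; rewrite sum_block_ord; case: ltnP; rewrite ?muln1 ?muln0.
  rewrite ler_wpM2l ?exprn_ge0// ler_wpM2l// NJ natrM.
  by rewrite le_eqVlt; apply/orP; left; apply/eqP; field; rewrite !pnatr_eq0 -!lt0n N0 J0.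
have {}S2b : 2 * `|S| <= J%:R ^+ r * (M.+1%:R ^+ r * D * (r%:R / N%:R)).
  move: S2b; rewrite normrM ger0_norm// => h; apply: (le_trans h).
  by rewrite le_eqVlt; apply/orP; left; apply/eqP; ring.
have J0' : 0 < J%:R ^+ r :> R by rewrite exprn_gt0// ltr0n.
rewrite AS normrM ger0_norm ?invr_ge0 ?exprn_ge0// ler_pdivrMl//.
by apply: le_trans S2b; have := normr_ge0 S; lra.
Qed.

(** * Lower and upper corners of a cell, and the mass between their orthants *)

Definition corner_lo (u : cells) : corners := [ffun i => widen_ord (leqnSn _) (u i)].
Definition corner_hi (u : cells) : corners := [ffun i => lift ord0 (u i)].

Lemma below_lo u c : below (corner_lo u) c = [forall i, (c i < u i)%N].
Proof. by apply: eq_forallb => i; rewrite ffunE. Qed.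

Lemma below_hi u c : below (corner_hi u) c = [forall i, (c i <= u i)%N].
Proof. by apply: eq_forallb => i; rewrite ffunE/= /bump/= ltnS. Qed.

(** The two orthants differ by cells lying in [r] slabs, each one cell thick. *)
Lemma below_hi_lo u c :
  (below (corner_hi u) c)%:R - (below (corner_lo u) c)%:R <= \sum_j (c j == u j)%:R :> R.
Proof.
rewrite below_hi below_lo.
case: (boolP [exists j, c j == u j]) => [/existsP[j js]|].
  rewrite (bigD1 j)//= js; apply: (@le_trans _ _ 1).
    by do 2 case: forallP => _; rewrite ?subrr ?subr0 ?sub0r ?ler0N1 // lerNl oppr0.
  by rewrite lerDl sumr_ge0.
rewrite negb_exists => /forallP h.
rewrite (_ : [forall i, (c i <= u i)%N] = [forall i, (c i < u i)%N]) ?subrr ?sumr_ge0//.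
by apply: eq_forallb => i; rewrite ltn_neqAle (h i).
Qed.

(** Each slab holds a fraction [1 / M.+1] of all cells, so a cdf with bounded density varies little
    across one cell. *)
Lemma slab_mass (q : cells -> R) (Q : R) u : (forall c, 0 <= q c <= Q) ->
  M.+1%:R ^- r * \sum_c q c * (below (corner_hi u) c)%:R
  - M.+1%:R ^- r * \sum_c q c * (below (corner_lo u) c)%:R <= Q * (r%:R / M.+1%:R).
Proof.
move=> qQ; rewrite -mulrBr -sumrB ler_pdivrMl ?exprn_gt0//.
apply: (@le_trans _ _ (\sum_(c : cells) Q * \sum_j (c j == u j)%:R)).
  apply: ler_sum => c _; have /andP[q0 q1] := qQ c; rewrite -mulrBr.
  apply: (@le_trans _ _ (q c * \sum_j (c j == u j)%:R)).
    by rewrite ler_wpM2l// below_hi_lo.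
  by rewrite ler_wpM2r// sumr_ge0.
have Q0 : 0 <= Q by have := qQ u; lra.
rewrite -big_distrr/= mulrCA ler_wpM2l//.
apply: le_trans (sum_cells_le (P := fun j v => v == u j) (m := 1) _) _; last by rewrite div1r.
by move=> j; rewrite (bigD1 (u j))//= eqxx big1 ?addr0// => v /negbTE ->.
Qed.
End grid.
End cells.

(** * The privatised histogram on the grid *)

Section discrete.
Variable R : realType.
Variables (r M N J n k : nat).
Hypotheses (NJ : M.+1 = (N * J)%N) (n0 : (0 < n)%N) (k0 : (0 < k)%N).
Local Notation cells := {ffun 'I_r -> 'I_M.+1}.
Local Notation corners := {ffun 'I_r -> 'I_M.+2}.

(* [block_frac s c] is the mass that the histogram built from one observation in the cell [c]
   gives to the cells below [s]; [cell_hist] is \hat f_{m,delta} as a function of cells. *)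
Definition block_frac (s : corners) (c : cells) : R :=
  J%:R ^- r * \sum_c' (same_block J c c')%:R * (below s c')%:R.

Definition cell_hist (delta : R) (x : 'I_n -> cells) (z : cells) : R :=
  (1 - delta) * ((\sum_i (same_block J (x i) z)%:R) / n%:R * (N ^ r)%:R) + delta.

Definition cell_hist_mass delta x z : R := M.+1%:R ^- r * cell_hist delta x z.

Lemma block_frac01 s c : 0 <= block_frac s c <= 1.
Proof.
have [N0 J0] := blocks_gt0 NJ.
have Jr : 0 < J%:R ^+ r :> R by rewrite exprn_gt0// ltr0n.
apply/andP; split.
  by rewrite mulr_ge0 ?invr_ge0 ?exprn_ge0// sumr_ge0// => c' _; exact: mulr_ge0.
rewrite ler_pdivrMl// mulr1 -(sum_same_block R NJ c); apply: ler_sum => c' _.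
by rewrite ler_piMr// lern1; case: below.
Qed.

Lemma natr_below01 (s : corners) (c : cells) : 0 <= ((below s c)%:R : R) <= 1.
Proof. by case: below; rewrite ?lexx ler01. Qed.

Section fixed_delta.
Variable delta : R.
Hypothesis delta01 : 0 <= delta <= 1.

Lemma cell_hist_ge0 x z : 0 <= cell_hist delta x z.
Proof.
have /andP[d0 d1] := delta01.
by rewrite addr_ge0// mulr_ge0 ?subr_ge0// mulr_ge0// divr_ge0// sumr_ge0.
Qed.

Let MNJ : M.+1%:R ^+ r = (N ^ r)%:R * J%:R ^+ r :> R.
Proof. by rewrite NJ natrM exprMn natrX. Qed.

Let Nr0 : (N ^ r)%:R != 0 :> R.
Proof. by have [N0 J0] := blocks_gt0 NJ; rewrite pnatr_eq0 -lt0n expn_gt0 N0. Qed.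

Let Jr0 : J%:R ^+ r != 0 :> R.
Proof. by have [N0 J0] := blocks_gt0 NJ; rewrite expf_neq0// pnatr_eq0 -lt0n. Qed.

Let nR0 : n%:R != 0 :> R. Proof. by rewrite pnatr_eq0 -lt0n. Qed.

(** The privatised histogram is a mixture: weight [1 - delta] on the average of the uniform laws on
    the blocks of the observations, weight [delta] on the uniform law. *)
Lemma sum_cell_hist_mass_fun x (f : cells -> R) :
  \sum_z cell_hist_mass delta x z * f z =
  (1 - delta) * ((\sum_i J%:R ^- r * \sum_z (same_block J (x i) z)%:R * f z) / n%:R)
  + delta * (M.+1%:R ^- r * \sum_z f z).
Proof.
transitivity (\sum_z ((1 - delta) * J%:R ^- r / n%:R * ((\sum_i (same_block J (x i) z)%:R) * f z)
  + delta * M.+1%:R ^- r * f z)).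
  apply: eq_bigr => z _; rewrite /cell_hist_mass /cell_hist MNJ.
  by field; rewrite nR0 Jr0 Nr0.
have -> : \sum_i J%:R ^- r * \sum_z (same_block J (x i) z)%:R * f z =
    J%:R ^- r * \sum_z (\sum_i (same_block J (x i) z)%:R) * f z.
  rewrite -big_distrr/= exchange_big/=; congr (_ * _).
  by apply: eq_bigr => z _; rewrite big_distrl.
by rewrite big_split/= -!big_distrr/=; ring.
Qed.

Lemma sum_cell_hist_mass x : \sum_z cell_hist_mass delta x z = 1.
Proof.
transitivity (\sum_z cell_hist_mass delta x z * 1); first by under [RHS]eq_bigr do rewrite mulr1.
rewrite sum_cell_hist_mass_fun; under eq_bigr => i _.
  under eq_bigr do rewrite mulr1.
  rewrite (sum_same_block R NJ) mulVf//; over.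
rewrite !sumr_const card_ord card_ffun !card_ord natrX mulVf ?expf_neq0//.
by field.
Qed.

Variables (pi : cells -> R) (D : R).
Hypotheses (pi0 : forall c, 0 <= pi c) (pi1 : \sum_c pi c = 1) (D0 : 0 <= D).
Hypothesis piD : forall c c', same_block J c c' -> `|pi c - pi c'| <= D.

(** Triangle inequality through the cdf of the privatised histogram, its unmixed version and the
    mean of the latter. The errors are those of sampling [z], of mixing, of sampling [x], and the
    bias. *)
Lemma max_dev_below_split (x : {ffun 'I_n -> cells}) (z : {ffun 'I_k -> cells}) :
  max_dev pi (fun s c => (below s c)%:R) z <=
  max_dev (cell_hist_mass delta x) (fun s c => (below s c)%:R) z +
  max_dev pi block_frac x + (delta + M.+1%:R ^+ r * D * (r%:R / N%:R)).
Proof.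
have max_dev0 (T : finType) m (w : T -> R) (g : corners -> T -> R) (y : 'I_m -> T) :
  0 <= max_dev w g y by apply: bigmax_ge_id.
have bias0 : 0 <= M.+1%:R ^+ r * D * (r%:R / N%:R).
  by rewrite !mulr_ge0 ?exprn_ge0 ?invr_ge0.
have /andP[d0 d1] := delta01.
apply: bigmax_le => [|s _]; first by rewrite !addr_ge0.
have h1 := max_dev_ge (cell_hist_mass delta x) (fun s c => (below s c)%:R : R) z s.
have h2 := max_dev_ge pi block_frac x s.
have h3 : `|\sum_c pi c * block_frac s c - \sum_c pi c * (below s c)%:R| <=
    M.+1%:R ^+ r * D * (r%:R / N%:R) := block_average_bias NJ s D0 piD.
rewrite sum_cell_hist_mass_fun -/(block_frac s _) in h1.
set E := _ / k%:R in h1 *.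
set Hh := _ / n%:R in h1; set U := _ * \sum_z _ in h1.
have U01 : 0 <= U <= 1.
  rewrite /U mulr_ge0 ?sumr_ge0 ?invr_ge0 ?exprn_ge0//= ler_pdivrMl ?exprn_gt0// mulr1.
  apply: (@le_trans _ _ (\sum_(c : cells) 1)).
    by apply: ler_sum => c _; case/andP: (natr_below01 s c).
  by rewrite sumr_const card_ffun !card_ord natrX.
have Hh01 : 0 <= Hh <= 1.
  rewrite /Hh divr_ge0 ?sumr_ge0//=; last first.
    by move=> i _; case/andP: (block_frac01 s (x i)).
  rewrite ler_pdivrMr ?ltr0n// mul1r.
  apply: (@le_trans _ _ (\sum_(i < n) 1)).
    by apply: ler_sum => c _; case/andP: (block_frac01 s (x c)).
  by rewrite sumr_const card_ord.
have {}h2 : `|Hh - \sum_c pi c * block_frac s c| <= max_dev pi block_frac x by [].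
move: h1 h2 h3; rewrite !ler_norml.
(* Mixing shifts the histogram cdf [Hh] by [delta * (U - Hh)], and both cdfs lie in [0,1]. *)
have dHU : - delta <= delta * (U - Hh) <= delta by nra.
rewrite (_ : (1 - delta) * Hh + _ = Hh + delta * (U - Hh)); last by ring.
lra.
Qed.

(** [expected_max_dev] is used twice over the same corners: for [z] given [x] with orthant
    indicators, then for [x] with [block_frac]. *)
Lemma discrete_ks_bound (B l : R) :
  0 <= B -> 1 <= l -> #|{: corners}|%:R <= expR (B * l) ->
  \sum_(x : {ffun 'I_n -> cells}) \sum_(z : {ffun 'I_k -> cells})
    max_dev pi (fun s c => (below s c)%:R) z *
      ((\prod_i pi (x i)) * \prod_l cell_hist_mass delta x (z l)) <=
  (B + 4) * Num.sqrt (l / k%:R) + (B + 4) * Num.sqrt (l / n%:R) +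
  (delta + M.+1%:R ^+ r * D * (r%:R / N%:R)).
Proof.
move=> B0 l1 cB.
have mass0 x z : 0 <= cell_hist_mass delta x z.
  by rewrite mulr_ge0 ?invr_ge0 ?exprn_ge0 ?cell_hist_ge0.
set bias := delta + _.
set g : corners -> cells -> R := fun s c => (below s c)%:R.
apply: (@le_trans _ _ (\sum_(x : {ffun 'I_n -> cells}) (\prod_i pi (x i)) *
   ((B + 4) * Num.sqrt (l / k%:R) + max_dev pi block_frac x + bias))).
  apply: ler_sum => x _.
  rewrite (eq_bigr (fun z : {ffun 'I_k -> cells} => (\prod_i pi (x i)) *
    ((\prod_l cell_hist_mass delta x (z l)) * max_dev pi g z))); last by move=> z _; ring.
  rewrite -big_distrr/= ler_wpM2l ?prodr_ge0//.
  apply: (@le_trans _ _ (\sum_(z : {ffun 'I_k -> cells}) (\prod_l cell_hist_mass delta x (z l)) *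
     (max_dev (cell_hist_mass delta x) g z + (max_dev pi block_frac x + bias)))).
    apply: ler_sum => z _; rewrite ler_wpM2l ?prodr_ge0// addrA.
    exact: max_dev_below_split.
  under eq_bigr do rewrite mulrDr.
  rewrite big_split/= -big_distrl/= sum_prod_eq1 ?sum_cell_hist_mass// mul1r addrA.
  rewrite !lerD2r; apply: expected_max_dev => //.
  - exact: sum_cell_hist_mass.
  - by move=> s t; apply: natr_below01.
rewrite (eq_bigr (fun x : {ffun 'I_n -> cells} => (\prod_i pi (x i)) * max_dev pi block_frac x +
  ((\prod_i pi (x i)) * ((B + 4) * Num.sqrt (l / k%:R) + bias)))); last by move=> x _; ring.
rewrite big_split/= -big_distrl/= sum_prod_eq1// mul1r.
have : \sum_(x : {ffun 'I_n -> cells}) (\prod_i pi (x i)) * max_dev pi block_frac x <=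
   (B + 4) * Num.sqrt (l / n%:R).
  apply: expected_max_dev => //; exact: block_frac01.
lra.
Qed.
End fixed_delta.
End discrete.

(** * From the integral to the grid *)

Section reduction.
Variable R : realType.

(** The Euclidean norm is at most the sum of the absolute coordinates. *)
Lemma eucl_dist_le r (x y : 'I_r -> R) (d : R) :
  (forall i, `|x i - y i| <= d) -> eucl_dist x y <= r%:R * d.
Proof.
move=> xyd; set T := \sum_i `|x i - y i|.
have Td : T <= r%:R * d.
  by rewrite mulr_natl -[r in _ *+ r](card_ord r) -sumr_const; apply: ler_sum.
have T0 : 0 <= T by apply: sumr_ge0.
apply: le_trans Td; rewrite /eucl_dist -[leRHS](ger0_norm T0) -sqrtr_sqr ler_wsqrtr//.
rewrite [leRHS]expr2 {1}/T big_distrl/=; apply: ler_sum => i _.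
rewrite -real_normK ?num_real// expr2 ler_wpM2l// /T (bigD1 i)//= lerDl sumr_ge0//.
Qed.

(** * Fine and coarse bins of a coordinate *)

Section bins.
Variables (M N J : nat).
Hypothesis NJ : M.+1 = (N * J)%N.

(** The right inequality is not strict, since the last bin contains 1. *)
Lemma bin_index_itv (u : R) : 0 <= u <= 1 ->
  (bin_index M.+1 u)%:R / M.+1%:R <= u <= (bin_index M.+1 u).+1%:R / M.+1%:R.
Proof.
move=> /andP[u0 u1]; have M0 : 0 < M.+1%:R :> R by rewrite ltr0n.
have uM : 0 <= u * M.+1%:R by rewrite mulr_ge0.
have /andP[h1 h2] := truncn_itv uM.
rewrite ler_pdivrMr// ler_pdivlMr// /bin_index -[M.+1.-1]/M.
have [le|lt] := leqP (Num.truncn (u * M.+1%:R)) M.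
  by rewrite h1 ltW.
apply/andP; split.
  by apply: le_trans h1; rewrite ler_nat ltnW.
by rewrite -[leRHS]mul1r ler_pM2r.
Qed.

Lemma le_bin_index (u t : R) : u <= t -> (bin_index M.+1 u <= bin_index M.+1 t)%N.
Proof.
move=> ut; rewrite /bin_index leq_min geq_minr andbT geq_min le_truncn//.
by rewrite ler_pM2r ?ltr0n.
Qed.

(** Nested floors: $\lfloor\lfloor uNJ\rfloor/J\rfloor = \lfloor uN\rfloor$. The endpoint [u = 1] is
    treated apart, as both indices are capped there. *)
Lemma bin_index_coarse (u : R) : 0 <= u <= 1 ->
  bin_index N u = (bin_index M.+1 u %/ J)%N.
Proof.
move=> /andP[u0 u1]; have [N0 J0] := blocks_gt0 NJ.
have NR : 0 < N%:R :> R by rewrite ltr0n.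
have JR : 0 < J%:R :> R by rewrite ltr0n.
have uM : 0 <= u * M.+1%:R by rewrite mulr_ge0.
have uN : 0 <= u * N%:R by rewrite mulr_ge0.
have [uE|u1'] := eqVneq u 1.
  rewrite uE /bin_index !mul1r !natrK (minn_idPr (leq_pred _)) (minn_idPr (leqnSn M))/=.
  apply/esym/eqP; rewrite eqn_leq -ltnS prednK// ltn_divLR// -NJ ltnSn leq_divRL//.
  by rewrite -ltnS NJ -(@prednK N)// mulSn; lia.
have {u1 u1'} u1 : u < 1 by rewrite lt_neqAle u1'.
have h1 : (Num.truncn (u * M.+1%:R) < M.+1)%N.
  by rewrite truncn_lt_nat// gtr_pMl// ltr0n.
have h2 : (Num.truncn (u * N%:R) < N)%N.
  by rewrite truncn_lt_nat// gtr_pMl.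
rewrite /bin_index (minn_idPl _); last by rewrite -ltnS prednK.
rewrite (minn_idPl _); last by rewrite -ltnS.
apply/eqP; rewrite truncn_eq//.
have /andP[g1 g2] := truncn_itv uM.
set b := Num.truncn (u * M.+1%:R) in g1 g2 *.
rewrite NJ natrM mulrA in g1 g2.
apply/andP; split.
  rewrite -(ler_pM2r JR); apply: le_trans g1; rewrite -natrM ler_nat; exact: leq_trunc_div.
rewrite -(ltr_pM2r JR); apply: lt_le_trans g2 _; rewrite -natrM ler_nat.
by rewrite ltn_ceil.
Qed.
End bins.

Definition cell_of r M (x : 'I_r -> R) : {ffun 'I_r -> 'I_M.+1} :=
  [ffun j => inord (bin_index M.+1 (x j))].

Lemma cell_ofE r M (x : 'I_r -> R) i : cell_of M x i = bin_index M.+1 (x i) :> nat.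
Proof. by rewrite ffunE inordK// bin_index_lt. Qed.

(** A strictly smaller bin index decides the order of two coordinates, equal indices do not; hence
    the orthant of [t] is bracketed by those of two corners of its cell. *)
Lemma below_lo_le_cw r M (x t : 'I_r -> R) :
  below (corner_lo (cell_of M t)) (cell_of M x) -> le_cw x t.
Proof.
rewrite below_lo => /forallP h; apply/forallP => i; have := h i; rewrite !cell_ofE.
by apply: contraTT; rewrite -ltNge -leqNgt => /ltW; exact: le_bin_index.
Qed.

Lemma le_cw_below_hi r M (x t : 'I_r -> R) :
  le_cw x t -> below (corner_hi (cell_of M t)) (cell_of M x).
Proof.
rewrite below_hi => /forallP h; apply/forallP => i; rewrite !cell_ofE.
exact/le_bin_index/h.
Qed.

Lemma natr_card (I : finType) (P : pred I) : #|[set i | P i]%classic|%:R = \sum_i (P i)%:R :> R.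
Proof.
rewrite -sum1_card natr_sum big_mkcond; apply: eq_bigr => i _.
have -> : (i \in [set i | P i]%classic) = P i by apply/idP/idP => [/set_mem//|]; rewrite inE.
by case: (P i).
Qed.

Lemma ecdfE r k (Z : 'I_k -> 'I_r -> R) t :
  ecdf Z t = (\sum_l (le_cw (Z l) t)%:R) / k%:R.
Proof. by rewrite /ecdf natr_card. Qed.

(** Coarse bins are unions of cells, so this density sees points only through their cells: passing
    to the grid is exact here. *)
Lemma hist_deltaE r M N J n delta (X : 'I_n -> 'I_r -> R) (x : 'I_r -> R) :
  M.+1 = (N * J)%N -> (forall i, unit_cube (X i)) -> unit_cube x ->
  hist_delta N delta X x = cell_hist N J delta (fun i => cell_of M (X i)) (cell_of M x).
Proof.
move=> NJ X01 x01; rewrite /hist_delta /hist /cell_hist natr_card.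
congr (_ * (_ / _ * _) + _); apply: eq_bigr => i _; congr (_ %:R); congr nat_of_bool.
by apply: eq_forallb => j; rewrite !cell_ofE (bin_index_coarse NJ (X01 i j)) (bin_index_coarse NJ (x01 j)).
Qed.

(** * Step approximation of the density and of its cdf *)

Section density.
Variables (r M : nat) (p : ('I_r -> R) -> R) (L : R).
Hypotheses (L0 : 0 <= L) (p0 : forall x, unit_cube x -> 0 <= p x).
Hypothesis p1 : cube_int p = 1%E.
Hypothesis pL : forall x y, unit_cube x -> unit_cube y ->
  `|p x - p y| <= L * eucl_dist x y.
Local Notation cells := {ffun 'I_r -> 'I_M.+1}.
Local Notation corners := {ffun 'I_r -> 'I_M.+2}.

Definition cell_pt (c : cells) : 'I_r -> R := fun i => (c i)%:R / M.+1%:R.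

(** [r / M.+1] bounds the Euclidean diameter of a cell, so this bounds the oscillation of [p] on
    it. *)
Definition cell_osc : R := L * (r%:R / M.+1%:R).

Definition cell_majorant (c : cells) : R := p (cell_pt c) + cell_osc.

Definition majorant_mass : R := M.+1%:R ^- r * \sum_c cell_majorant c.

Definition majorant_cdf (s : corners) : R :=
  M.+1%:R ^- r * \sum_c cell_majorant c * (below s c)%:R.

(** The majorant has mass at least 1 and is normalised to a law on cells; the excess mass is paid
    once per observation. *)
Definition cell_weight (c : cells) : R :=
  M.+1%:R ^- r * cell_majorant c / majorant_mass.

Let M0 : 0 < M.+1%:R :> R. Proof. by rewrite ltr0n. Qed.
Let Mr0 : 0 < M.+1%:R ^+ r :> R. Proof. by rewrite exprn_gt0. Qed.

Lemma cell_osc_ge0 : 0 <= cell_osc.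
Proof. by rewrite mulr_ge0// divr_ge0. Qed.

Lemma cell_pt_unit c : unit_cube (cell_pt c).
Proof.
move=> i; rewrite divr_ge0//= ler_pdivrMr// mul1r ler_nat ltnW//.
Qed.

Lemma lipschitz_sup x y d : unit_cube x -> unit_cube y ->
  (forall i, `|x i - y i| <= d) -> `|p x - p y| <= L * (r%:R * d).
Proof.
by move=> x01 y01 xyd; apply: (le_trans (pL x01 y01)); rewrite ler_wpM2l// eucl_dist_le.
Qed.

Lemma cell_majorant_approx x : unit_cube x ->
  p x <= cell_majorant (cell_of M x) <= p x + 2 * cell_osc.
Proof.
move=> x01; have : `|p x - p (cell_pt (cell_of M x))| <= L * (r%:R * M.+1%:R^-1).
  apply: lipschitz_sup => //; first exact: cell_pt_unit.
  move=> i; rewrite /cell_pt cell_ofE; have := bin_index_itv M (x01 i).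
  rewrite -[(bin_index _ _).+1%:R]natr1 mulrDl mul1r => /andP[h1 h2].
  by rewrite ger0_norm ?subr_ge0// lerBlDl.
rewrite -/cell_osc ler_norml /cell_majorant; lra.
Qed.

Lemma cell_majorant_ge0 c : 0 <= cell_majorant c.
Proof. by rewrite addr_ge0 ?cell_osc_ge0//; apply/p0/cell_pt_unit. Qed.

Lemma iint_cell_of (G : cells -> R) : (forall c, 0 <= G c) ->
  cube_int (fun x : 'I_r -> R => G (cell_of M x)) = (M.+1%:R ^- r * \sum_c G c)%:E.
Proof. exact: iint_cell. Qed.

Lemma le_cube_int (f g : ('I_r -> R) -> R) :
  (forall x, unit_cube x -> f x <= g x) -> (cube_int f <= cube_int g)%E.
Proof. by move=> fg; apply: le_iint => v v01; rewrite lee_fin fg// => i; apply: v01. Qed.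

(** Truncation at 0 keeps the step minorant nonnegative, as [iint_cell_of] requires. *)
Let lower (c : cells) : R := Num.max 0 (cell_majorant c - 2 * cell_osc).

Let lower_ge0 c : 0 <= lower c. Proof. by rewrite le_max lexx. Qed.

Let lower_ge c : cell_majorant c - 2 * cell_osc <= lower c.
Proof. by rewrite le_max lexx orbT. Qed.

Let lower_le x : unit_cube x -> lower (cell_of M x) <= p x.
Proof.
by move=> x01; rewrite ge_max p0//=; have := cell_majorant_approx x01; lra.
Qed.

(** Integrate the step bounds around [p], whose own integral is 1. *)
Lemma majorant_mass_itv : 1 <= majorant_mass <= 1 + 2 * cell_osc.
Proof.
have h1 : (cube_int p <= majorant_mass%:E)%E.
  rewrite -iint_cell_of; last exact: cell_majorant_ge0.
  by apply: le_cube_int => x /cell_majorant_approx/andP[].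
have h2 : ((M.+1%:R ^- r * \sum_c lower c)%:E <= cube_int p)%E.
  by rewrite -iint_cell_of//; apply: le_cube_int.
rewrite p1 lee_fin in h1; rewrite p1 lee_fin in h2.
rewrite h1/= -lerBlDr; apply: le_trans h2.
rewrite (_ : _ - _ = M.+1%:R ^- r * \sum_c (cell_majorant c - 2 * cell_osc)).
  by rewrite ler_pM2l ?invr_gt0//; apply: ler_sum.
rewrite sumrB sumr_const card_ffun !card_ord -[_ *+ (_ ^ _)]mulr_natr natrX.
by rewrite /majorant_mass; field; rewrite gt_eqF.
Qed.

(** The same bracketing for [p] cut off at [t], with the smaller orthant below and the larger one
    above. *)
Lemma cdf_itv t : unit_cube t ->
  majorant_cdf (corner_lo (cell_of M t)) - 2 * cell_osc <= Defs.cdf p t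
  <= majorant_cdf (corner_hi (cell_of M t)).
Proof.
move=> t01; set hi := corner_hi _; set lo := corner_lo _.
pose f x : R := if le_cw x t then p x else 0.
have h1 : (cube_int f <= (majorant_cdf hi)%:E)%E.
  rewrite -iint_cell_of; last by move=> c; rewrite mulr_ge0 ?cell_majorant_ge0.
  apply: le_cube_int => x x01; rewrite /f; case: ifP => [xt|_].
    by rewrite le_cw_below_hi// mulr1; case/andP: (cell_majorant_approx x01).
  by rewrite mulr_ge0 ?cell_majorant_ge0.
have h2 : ((M.+1%:R ^- r * \sum_c lower c * (below lo c)%:R)%:E <=
    cube_int f)%E.
  rewrite -iint_cell_of; last by move=> c; rewrite mulr_ge0.
  apply: le_cube_int => x x01; rewrite /f; case: (boolP (below lo (cell_of M x))) => [/below_lo_le_cw -> |_].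
    by rewrite mulr1 lower_le.
  by rewrite mulr0; case: ifP => // _; exact: p0.
(* Both bounds are real, so the integral is finite and [fine] loses nothing. *)
rewrite /Defs.cdf -/f; move: h1 h2; case: (cube_int _) => [v| |]; rewrite ?lee_fin ?leye_eq ?leeNy_eq//=.
move=> -> h2; rewrite andbT; apply: le_trans h2.
rewrite lerBlDr -lerBlDl /majorant_cdf -mulrBr -sumrB ler_pdivrMl//.
apply: (@le_trans _ _ (\sum_(c : cells) 2 * cell_osc)).
  apply: ler_sum => c _; rewrite -mulrBl; have := lower_ge c; have := cell_osc_ge0.
  by case: below; rewrite ?mulr1 ?mulr0; lra.
by rewrite sumr_const card_ffun !card_ord -[_ *+ _]mulr_natr natrX mulrC.
Qed.

Lemma majorant_mass_gt0 : 0 < majorant_mass.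
Proof. by have := majorant_mass_itv; lra. Qed.

Lemma cell_weight_ge0 c : 0 <= cell_weight c.
Proof.
by rewrite divr_ge0 ?(ltW majorant_mass_gt0)// mulr_ge0 ?cell_majorant_ge0.
Qed.

Lemma sum_cell_weight : \sum_c cell_weight c = 1.
Proof.
by rewrite -big_distrl/= -big_distrr/= -/majorant_mass divff// gt_eqF// majorant_mass_gt0.
Qed.

Lemma cell_majorantE c : cell_majorant c = majorant_mass * M.+1%:R ^+ r * cell_weight c.
Proof.
by rewrite /cell_weight; field; rewrite (gt_eqF majorant_mass_gt0) gt_eqF.
Qed.

Lemma majorant_cdfE s :
  majorant_cdf s = majorant_mass * \sum_c cell_weight c * (below s c)%:R.
Proof.
rewrite /majorant_cdf.
rewrite (eq_bigr (fun c => majorant_mass * M.+1%:R ^+ r *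
  (cell_weight c * (below s c)%:R))); last by move=> c _; rewrite [in LHS]cell_majorantE mulrA.
by rewrite -big_distrr/=; field; rewrite gt_eqF.
Qed.

(** Cells of one block differ by at most [1 / N] per axis; the added oscillation cancels in the
    difference, and dividing by a mass at least 1 only shrinks it. *)
Lemma cell_weight_lip N J c c' : M.+1 = (N * J)%N -> same_block J c c' ->
  `|cell_weight c - cell_weight c'| <= M.+1%:R ^- r * (L * (r%:R / N%:R)).
Proof.
move=> NJ /forallP cc'; have [N0 J0] := blocks_gt0 NJ.
have -> : cell_weight c - cell_weight c' =
    M.+1%:R ^- r * (majorant_mass^-1 * (cell_majorant c - cell_majorant c')).
  by rewrite /cell_weight; ring.
rewrite !normrM [`|M.+1%:R ^- r|]gtr0_norm ?invr_gt0// ler_pM2l ?invr_gt0//.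
rewrite [`|majorant_mass^-1|]gtr0_norm ?invr_gt0 ?majorant_mass_gt0//.
have h : `|cell_majorant c - cell_majorant c'| <= L * (r%:R / N%:R).
  rewrite /cell_majorant opprD addrACA subrr addr0; apply: lipschitz_sup; [exact: cell_pt_unit..|].
  move=> i; rewrite /cell_pt -mulrBl normrM [X in _ * X]ger0_norm ?invr_ge0//.
  have NJR : M.+1%:R = N%:R * J%:R :> R by rewrite NJ natrM.
  rewrite ler_pdivrMr// NJR mulKf ?pnatr_eq0 -?lt0n//.
  have b1 := ltn_ceil (c i) J0; have b2 := leq_trunc_div (c i) J.
  have b3 := ltn_ceil (c' i) J0; have b4 := leq_trunc_div (c' i) J.
  have e := eqP (cc' i); rewrite e in b1 b2.
  have h1 : (c i <= c' i + J)%N by lia.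
  have h2 : (c' i <= c i + J)%N by lia.
  rewrite -(ler_nat R) natrD in h1; rewrite -(ler_nat R) natrD in h2.
  rewrite ler_norml; lra.
apply: le_trans h; rewrite ler_piMl// invf_le1 ?majorant_mass_gt0//.
by case/andP: majorant_mass_itv.
Qed.

(** Up to oscillation terms, both cdfs at [t] lie between their values at the two corners of the
    cell of [t]; the gap is the mass of slabs. *)
Lemma ks_dev_le k (Z : 'I_k -> 'I_r -> R) (Q : R) :
  (forall c, cell_majorant c <= Q) ->
  (ks_dev p Z <= (max_dev cell_weight (fun s c => (below s c)%:R : R)
       [ffun l => cell_of M (Z l)] + (Q * (r%:R / M.+1%:R) + 2 * cell_osc))%:E)%E.
Proof.
move=> qQ; apply: ge_ereal_sup => _ [t t01 <-]; rewrite lee_fin.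
set u := cell_of M t; set z := [ffun l => _]; set md := max_dev _ _ _.
have [F1 F2] := andP (cdf_itv t01); rewrite -/u in F1 F2.
have slab : majorant_cdf (corner_hi u) - majorant_cdf (corner_lo u) <= Q * (r%:R / M.+1%:R).
  by apply: slab_mass => c; rewrite cell_majorant_ge0 qQ.
have [S1 S2] := andP majorant_mass_itv.
have dlo := max_dev_ge cell_weight (fun s c => (below s c)%:R : R) z (corner_lo u).
have dhi := max_dev_ge cell_weight (fun s c => (below s c)%:R : R) z (corner_hi u).
rewrite -/md /= in dlo dhi.
have elo : (\sum_l (below (corner_lo u) (z l))%:R) / k%:R <= ecdf Z t.
  rewrite ecdfE ler_wpM2r ?invr_ge0//; apply: ler_sum => l _; rewrite ffunE ler_nat.
  by case: (boolP (below _ _)) => // /below_lo_le_cw ->.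
have ehi : ecdf Z t <= (\sum_l (below (corner_hi u) (z l))%:R) / k%:R.
  rewrite ecdfE ler_wpM2r ?invr_ge0//; apply: ler_sum => l _; rewrite ffunE ler_nat.
  by case: (boolP (le_cw _ _)) => // /le_cw_below_hi ->.
(* The two sides differ by the factor [majorant_mass], and the sum is at most 1. *)
have P01 s : majorant_cdf s - 2 * cell_osc <= \sum_c cell_weight c * (below s c)%:R <= majorant_cdf s.
  set P := \sum_c _.
  have P0 : 0 <= P by apply: sumr_ge0 => c _; rewrite mulr_ge0 ?cell_weight_ge0.
  have P1 : P <= 1.
    rewrite -sum_cell_weight; apply: ler_sum => c _.
    by rewrite ler_piMr ?cell_weight_ge0//; case/andP: (natr_below01 R s c).
  by rewrite majorant_cdfE -/P; have := cell_osc_ge0; nra.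
have [l1 l2] := andP (P01 (corner_lo u)); have [h1 h2] := andP (P01 (corner_hi u)).
have arith (F E Fl Fh Pl Ph El Eh m a o : R) :
    Fl - 2 * o <= F -> F <= Fh -> Fh - Fl <= a -> El <= E -> E <= Eh ->
    Fl - 2 * o <= Pl -> Ph <= Fh -> `|El - Pl| <= m -> `|Eh - Ph| <= m ->
    `|F - E| <= m + (a + 2 * o).
  by rewrite !ler_norml => *; lra.
exact: (arith _ _ _ _ _ _ _ _ _ _ _ F1 F2 slab elo ehi l1 h2 dlo dhi).
Qed.

(** The integrand is dominated factor by factor: the deviation at an additive cost [eta], the [n]
    values of [p] by their majorants. [discrete_ks_bound] then applies to the normalised weights. *)
Lemma expected_ks_bound n k N J (delta Q B l : R) : M.+1 = (N * J)%N ->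
  (0 < n)%N -> (0 < k)%N -> 0 <= delta <= 1 -> (forall c, cell_majorant c <= Q) ->
  0 <= B -> 1 <= l -> #|{: corners}|%:R <= expR (B * l) ->
  (expected_ks r n k N delta p <=
    ((1 + 2 * cell_osc) ^+ n *
    ((B + 4) * Num.sqrt (l / k%:R) + (B + 4) * Num.sqrt (l / n%:R) +
     (delta + L * (r%:R / N%:R) ^+ 2) + (Q * (r%:R / M.+1%:R) + 2 * cell_osc)))%:E)%E.
Proof.
move=> NJ n0 k0 delta01 qQ B0 l1 cB.
pose eta := Q * (r%:R / M.+1%:R) + 2 * cell_osc.
have eta0 : 0 <= eta.
  rewrite addr_ge0 ?mulr_ge0 ?divr_ge0 ?cell_osc_ge0//.
  by apply: le_trans (qQ [ffun=> ord0]); exact: cell_majorant_ge0.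
pose G (x : {ffun 'I_n -> cells}) (z : {ffun 'I_k -> cells}) : R :=
  (max_dev cell_weight (fun s c => (below s c)%:R : R) z + eta) *
  ((\prod_i cell_majorant (x i)) * \prod_l cell_hist N J delta x (z l)).
have md0 z : 0 <= max_dev cell_weight (fun (s : corners) c => (below s c)%:R : R) (z : {ffun 'I_k -> cells}).
  exact: bigmax_ge_id.
have G0 x z : 0 <= G x z.
  apply: mulr_ge0; first by rewrite addr_ge0.
  by apply: mulr_ge0; apply: prodr_ge0 => *; [exact: cell_majorant_ge0|exact: cell_hist_ge0].
apply: (@le_trans _ _ (iint ((n + k) * r) (fun v =>
    let b := blocks r M n k (fun j => bin_index M.+1 (v j)) in (G b.1 b.2)%:E))).
  apply: le_iint => v v01 /=.
  have X01 i : unit_cube (@Xof R r n v i) by move=> j; apply: v01.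
  have Z01 i : unit_cube (@Zof R r n k v i) by move=> j; apply: v01.
  rewrite /G [leRHS]EFinM; apply: lee_pmul.
  (* The value at [t = 0] shows that the supremum is nonnegative. *)
  - apply: le_ereal_sup_tmp; exists `|Defs.cdf p (fun=> 0) - ecdf (@Zof R r n k v) (fun=> 0)|%:E.
      by exists (fun=> 0) => // i; rewrite lexx ler01.
    by rewrite lee_fin.
  - rewrite lee_fin mulr_ge0// prodr_ge0// => i _; first exact: p0.
    by rewrite (hist_deltaE delta NJ X01 (Z01 i)) cell_hist_ge0.
  - exact: ks_dev_le.
  - rewrite lee_fin; apply: ler_pM.
    + by apply: prodr_ge0 => i _; exact: p0.
    + by apply: prodr_ge0 => i _; rewrite (hist_deltaE delta NJ X01 (Z01 i)) cell_hist_ge0.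
    + apply: ler_prod => i _; rewrite p0//= ffunE.
      by have /andP[+ _] := cell_majorant_approx (X01 i).
    + apply: ler_prod => i _; rewrite (hist_deltaE delta NJ X01 (Z01 i)) cell_hist_ge0//= ffunE.
      rewrite le_eqVlt; apply/orP; left; apply/eqP; rewrite /cell_hist.
      by congr (_ * (_ / _ * _) + _); apply: eq_bigr => j _; rewrite ffunE.
rewrite iint_blocks// lee_fin.
have S0 := majorant_mass_gt0; have [S1 S2] := andP majorant_mass_itv.
have mass0 x z : 0 <= cell_hist_mass N J delta x z.
  by rewrite mulr_ge0 ?invr_ge0 ?(ltW Mr0) ?cell_hist_ge0.
(* Each of the [n + k] points absorbs one cell volume into its weight, which cancels the prefactor
   and leaves [majorant_mass ^+ n]. *)
have GE x z : G x z = M.+1%:R ^+ ((n + k) * r) * majorant_mass ^+ n *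
   ((max_dev cell_weight (fun s c => (below s c)%:R : R) z + eta) *
   ((\prod_i cell_weight (x i)) * \prod_l cell_hist_mass N J delta x (z l))).
  rewrite /G; under eq_bigr do rewrite cell_majorantE.
  rewrite big_split/= prodr_const card_ord.
  have -> : \prod_l cell_hist N J delta x (z l) =
     M.+1%:R ^+ r ^+ k * \prod_l cell_hist_mass N J delta x (z l).
    transitivity (\prod_(l < k) (M.+1%:R ^+ r * cell_hist_mass N J delta x (z l))).
      by apply: eq_bigr => i _; rewrite /cell_hist_mass mulrA divff ?mul1r// gt_eqF.
    by rewrite big_split/= prodr_const card_ord.
  by rewrite exprMn mulnC exprM exprD; ring.
under eq_bigr => x _.
  under eq_bigr => z _ do rewrite GE.
  rewrite -big_distrr/=; over.
rewrite -big_distrr/= mulrA mulrA mulVf ?mul1r; last by rewrite gt_eqF// exprn_gt0.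
have D0 : 0 <= M.+1%:R ^- r * (L * (r%:R / N%:R)) :> R.
  by rewrite !mulr_ge0 ?invr_ge0 ?(ltW Mr0).
have main := discrete_ks_bound NJ n0 k0 delta01 cell_weight_ge0 sum_cell_weight D0
  (fun c c' => @cell_weight_lip N J c c' NJ) B0 l1 cB.
(* One factor [r / N] bounds the variation of the density over a bin, the other the share of bins
   meeting the boundary. *)
rewrite (_ : M.+1%:R ^+ r * _ * _ = L * (r%:R / N%:R) ^+ 2) in main; last first.
  by rewrite mulVKf ?gt_eqF//; ring.
apply: ler_pM.
- by rewrite exprn_ge0// ltW.
- apply: sumr_ge0 => x _; apply: sumr_ge0 => z _; apply: mulr_ge0; first by rewrite addr_ge0.
  by apply: mulr_ge0; apply: prodr_ge0 => *; [exact: cell_weight_ge0|].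
- by rewrite lerXn2r// nnegrE; lra.
under eq_bigr => x _.
  under eq_bigr => z _ do rewrite mulrDl.
  rewrite big_split/= -[X in _ + X]big_distrr/= -[X in _ * X]big_distrr/=.
  rewrite sum_prod_eq1 ?mulr1; last exact: sum_cell_hist_mass.
  over.
rewrite big_split/= -[X in _ + X]big_distrr/= sum_prod_eq1 ?sum_cell_weight// mulr1.
by rewrite lerD2r.
Qed.
End density.
End reduction.

(** * Rates *)

Section asymptotics.
Variable R : realType.

(** In dimension 0 there is a single cube whatever [N], while [N ^ 0 = 1] gives no control on [N]; a
    positive value can then be substituted. *)
Lemma hist_dim0 r N N' n (X : 'I_n -> 'I_r -> R) (x : 'I_r -> R) :
  r = 0%N -> hist N X x = hist N' X x.
Proof.
move=> r0; have sb K (y z : 'I_r -> R) : same_bin K y z = true.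
  by apply/forallP => -[i ir]; exfalso; rewrite r0 in ir.
rewrite /hist !natr_card; congr (_ / _ * _); last by rewrite r0.
by apply: eq_bigr => i _; rewrite !sb.
Qed.

Lemma expected_ks_dim0 r n k N N' (delta : R) p :
  r = 0%N -> expected_ks r n k N delta p = expected_ks r n k N' delta p.
Proof.
move=> r0; rewrite /expected_ks; congr iint; apply/funext => w.
congr (_ * (_ * _)%:E)%E; apply: eq_bigr => l _.
by rewrite /hist_delta (hist_dim0 N N').
Qed.

Lemma powR_div_natX (x a : R) (r : nat) : 0 <= x -> (x `^ a^-1) ^+ r = x `^ (r%:R / a).
Proof. by move=> x0; rewrite -powR_mulrn ?powR_ge0// -powRrM mulrC. Qed.

(** Since $\min(c,1)^r \le c$, comparing [r]-th powers avoids a root of [c]. *)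
Lemma bins_lower_bound r N (c y : R) : (0 < r)%N -> 0 < c -> 0 <= y ->
  c * y ^+ r <= (N ^ r)%:R -> Num.min c 1 * y <= N%:R.
Proof.
move=> r0 c0 y0 h; set m := Num.min c 1.
have m0 : 0 < m by rewrite lt_min c0 ltr01.
have mc : m ^+ r <= c.
  apply: (@le_trans _ _ m); last by rewrite ge_min lexx.
  rewrite -[leRHS]expr1; apply: ler_wiXn2l => //; first exact: ltW.
  by rewrite ge_min lexx orbT.
rewrite -(@ler_pXn2r _ r)// ?nnegrE ?mulr_ge0 ?(ltW m0)//.
rewrite exprMn -natrX; apply: le_trans h; rewrite ler_wpM2r// exprn_ge0//.
Qed.

(** [S] is the factor from the majorant, [k'] and [b] the sampling errors, [d] the mixing, [b2] the
    bias, [e] the grid error. As [s], the root of the logarithm, is at least 1, all terms fit under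
    [s / E]. *)
Lemma sum_rates_le (S A k' s E b d b2 e C1 C2 C3 C4 C5 : R) :
  0 <= A -> 1 <= s -> 0 < E -> 0 <= S -> S <= C5 ->
  0 <= k' -> k' <= C1 * s / E -> b <= s / E ->
  0 <= d -> d <= C2 / E -> 0 <= b2 -> b2 <= C3 / E -> 0 <= e -> e <= C4 / E ->
  0 <= b -> S * (A * k' + A * b + (d + b2) + e) <= C5 * (A * C1 + A + C2 + C3 + C4) * s / E.
Proof.
move=> A0 s1 E0 S0 SC k0 kC bC d0 dC b0 b2C e0 eC bb0.
have up (C x : R) : 0 <= x -> x <= C / E -> x <= C * (s / E).
  move=> x0 xC; have C0 : 0 <= C by have := le_trans x0 xC; rewrite pmulr_lge0 ?invr_gt0.
  apply: (le_trans xC); rewrite ler_wpM2l// -[leLHS]mul1r ler_wpM2r// invr_ge0 ltW//.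
have d' := up _ _ d0 dC; have b2' := up _ _ b0 b2C; have e' := up _ _ e0 eC.
rewrite -!mulrA.
apply: ler_pM => //; first by rewrite !addr_ge0// mulr_ge0.
have h1 : A * k' <= A * (C1 * (s / E)) by rewrite ler_wpM2l// mulrA.
have h2 : A * b <= A * (s / E) by rewrite ler_wpM2l.
set u := s / E in h1 h2 d' b2' e' *.
rewrite (_ : _ * u = A * (C1 * u) + A * u + C2 * u + C3 * u + C4 * u); last by ring.
lra.
Qed.
End asymptotics.
Unset Implicit Arguments.

Theorem mainTheorem5 (R : realType) (r : nat) (p : ('I_r -> R) -> R) (L alpha : R)
  (Nb k : nat -> nat) :
  0 < L -> 0 < alpha ->
  (* p is a probability density on [0,1]^r *)
  (forall x, unit_cube x -> 0 <= p x) ->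
  cube_int p = 1%E ->
  (* Lipschitz *)
  (forall x y, unit_cube x -> unit_cube y -> `|p x - p y| <= L * eucl_dist x y) ->
  (* m = (Nb n)^r bins (binwidth h = 1/Nb n), m asymp n^{r/(6+r)} *)
  (exists c1 c2 : R, exists n0 : nat, 0 < c1 /\ 0 < c2 /\
     forall n, (n0 <= n)%N ->
       c1 * powR n%:R (r%:R / (6 + r%:R)) <= ((Nb n) ^ r)%:R /\
       ((Nb n) ^ r)%:R <= c2 * powR n%:R (r%:R / (6 + r%:R))) ->
  (* k asymp n^{4/(6+r)} *)
  (exists c1 c2 : R, exists n0 : nat, 0 < c1 /\ 0 < c2 /\
     forall n, (n0 <= n)%N ->
       c1 * powR n%:R (4 / (6 + r%:R)) <= (k n)%:R /\
       (k n)%:R <= c2 * powR n%:R (4 / (6 + r%:R))) ->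
  exists C : R, exists n0 : nat, forall n, (n0 <= n)%N ->
    (expected_ks r n (k n) (Nb n)
       (((Nb n) ^ r * k n)%:R / (n%:R * alpha)) p
     <= (C * Num.sqrt (ln n%:R) / powR n%:R (2 / (6 + r%:R)))%:E)%E.
Proof.
move=> L0 al0 p0 p1 pL [c1 [c2 [n1 [c10 [c20 hm]]]]] [d1 [d2 [n2 [d10 [d20 hk]]]]].
set a : R := 6 + r%:R in hm hk *.
have a6 : 6 <= a by rewrite /a lerDl.
have a0 : 0 < a by lra.
(* [c3] bounds [r / N] times $n^{1/a}$, [c4] bounds [delta] times $n^{2/a}$, and [Q] bounds the
   majorant. Taking [n] above [T] secures [ln n >= 1], [c2 <= n], [n >= 2], and [c4 <= E], hence
   [delta <= 1]. *)
pose c3 := r%:R / Num.min c1 1.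
pose c4 := c2 * d2 / alpha.
pose Q := p (fun=> 0) + 2 * (L * r%:R).
pose T := c2 + expR 1 + c4 `^ (a / 2) + 2.
have m0 : 0 < Num.min c1 1 by rewrite lt_min c10 ltr01.
have c40 : 0 < c4 by rewrite divr_gt0 ?mulr_gt0.
have c30 : 0 <= c3 by rewrite divr_ge0 ?(ltW m0).
exists (expR (2 * (L * r%:R)) * ((4 * r%:R + 4) * (Num.sqrt d1)^-1 + (4 * r%:R + 4)
  + c4 + L * c3 ^+ 2 + (Q * r%:R + 2 * (L * r%:R)))).
exists (n1 + n2 + (Num.truncn T).+1)%N => n nn.
have nT : T < n%:R.
  by apply: lt_le_trans (truncnS_gt T) _; rewrite ler_nat; exact: leq_trans (leq_addl _ _) nn.
have e10 := expR_gt0 (1 : R); have pw0 := powR_ge0 c4 (a / 2).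
have n2R : 2 <= n%:R :> R by rewrite /T in nT; lra.
have nR : 0 < n%:R :> R by lra.
have n2N : (2 <= n)%N by rewrite -(ler_nat R).
have n12 : (n1 + n2 <= n)%N by apply: leq_trans nn; exact: leq_addr.
have [hm1 hm2] := hm n (leq_trans (leq_addr _ _) n12).
have [hk1 hk2] := hk n (leq_trans (leq_addl _ _) n12).
set l := ln n%:R; set E := n%:R `^ (2 / a).
have l1 : 1 <= l by rewrite /l -[leLHS]expRK ler_ln ?posrE//; rewrite /T in nT; lra.
have E0 : 0 < E by apply: powR_gt0.
have E2 : n%:R `^ (4 / a) = E ^+ 2.
  by rewrite /E -powR_mulrn ?powR_ge0// -powRrM; congr (_ `^ _); field; rewrite gt_eqF.
have E2n : E ^+ 2 <= n%:R.
  rewrite -E2 -[leRHS]powRr1 ?(ltW nR)//; apply: ler_powR; first by lra.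
  by rewrite ler_pdivrMr//; lra.
have E1 : 1 <= E.
  by rewrite -[leLHS](powRr0 n%:R) /E; apply: ler_powR; [lra|rewrite divr_ge0 ?ltW].
have En : E <= n%:R by apply: le_trans E2n; rewrite expr2; nra.
have c4E : c4 <= E.
  rewrite (_ : c4 = (c4 `^ (a / 2)) `^ (2 / a)).
    apply: ge0_ler_powR; rewrite ?nnegrE//; first by rewrite divr_ge0// ltW.
    by rewrite /T in nT; lra.
  rewrite -powRrM (_ : a / 2 * (2 / a) = 1) ?powRr1 ?(ltW c40)//; field; rewrite gt_eqF//.
set delta := _ / (n%:R * alpha).
(* The exponents [r / a], [4 / a] and [2 / a] add up to 1. *)
have dE : delta <= c4 / E.
  rewrite /delta ler_pdivrMr ?mulr_gt0// natrM.
  apply: (@le_trans _ _ ((c2 * n%:R `^ (r%:R / a)) * (d2 * n%:R `^ (4 / a)))).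
    by rewrite ler_pM.
  rewrite (_ : c4 / E * (n%:R * alpha) = c2 * d2 * (n%:R / E)); last first.
    by rewrite /c4; field; rewrite !gt_eqF.
  rewrite mulrACA ler_wpM2l ?mulr_ge0 ?(ltW c20) ?(ltW d20)// ler_pdivlMr//.
  rewrite -!powRD ?(gt_eqF nR) ?implybT//.
  rewrite (_ : _ + _ + _ = 1) ?powRr1 ?(ltW nR)//.
  have r42 : r%:R + 4 + 2 = a by rewrite /a; ring.
  by rewrite -!mulrDl r42 divff// gt_eqF.
have d0 : 0 <= delta by rewrite divr_ge0// mulr_ge0// ltW.
have d01 : 0 <= delta <= 1.
  by rewrite d0/=; apply: (le_trans dE); rewrite ler_pdivrMr// mul1r.
have k0 : (0 < k n)%N.
  by rewrite -(ltr_nat R); apply: lt_le_trans hk1; rewrite mulr_gt0 ?powR_gt0.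
pose N := if r == 0%N then 1%N else Nb n.
have -> : expected_ks r n (k n) (Nb n) delta p = expected_ks r n (k n) N delta p.
  by rewrite /N; case: eqP => // /expected_ks_dim0; exact.
(* The crude bound [N <= n ^ 2] keeps the number of corners polynomial in [n]; the last bound makes
   the bias of order [1 / E]. *)
have Nfacts : [/\ (0 < N)%N, (N <= n ^ 2)%N & (r%:R / N%:R) ^+ 2 <= c3 ^+ 2 / E].
  rewrite /N; case: eqP => [r0|/eqP]; last rewrite -lt0n => r0.
    split; [by []|by rewrite expn_gt0 (ltnW n2N)|].
    by rewrite r0 mul0r expr0n/= divr_ge0 ?exprn_ge0// ltW.
  have Er : n%:R `^ (r%:R / a) = (n%:R `^ a^-1) ^+ r :> R by rewrite powR_div_natX ?(ltW nR).
  have y0 : 0 < n%:R `^ a^-1 :> R by apply: powR_gt0.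
  rewrite Er in hm1.
  have NL := bins_lower_bound r0 c10 (ltW y0) hm1.
  have N0 : (0 < Nb n)%N by rewrite -(ltr_nat R); apply: lt_le_trans NL; rewrite mulr_gt0.
  split; first exact: N0.
    rewrite -(ler_nat R); apply: (@le_trans _ _ ((Nb n ^ r)%:R)).
      by rewrite ler_nat -[leqLHS]expn1 leq_pexp2l.
    apply: (le_trans hm2); rewrite natrX expr2; apply: ler_pM; rewrite ?(ltW c20) ?powR_ge0//.
      by rewrite /T in nT; lra.
    rewrite -[leRHS]powRr1 ?(ltW nR)//; apply: ler_powR; first by lra.
    by rewrite ler_pdivrMr// /a; lra.
  have Ey : E = (n%:R `^ a^-1) ^+ 2 by rewrite powR_div_natX ?(ltW nR).
  rewrite Ey -expr_div_n; apply: lerXn2r; rewrite ?nnegrE ?divr_ge0 ?(ltW y0)//.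
    exact: ltW.
  rewrite /c3 -mulrA ler_wpM2l// -invfM lef_pV2 ?posrE ?mulr_gt0 ?ltr0n//.
move: Nfacts => [N0 Nn rN].
have Nn0 : (0 < N * n)%N by rewrite muln_gt0 N0 ltnW.
(* Each bin is cut into [n] cells per axis: cell errors become $O(1/n)$, and even the [n]-th power
   of [1 + 2 * cell_osc] stays bounded. *)
pose M := (N * n).-1; have NJ : M.+1 = (N * n)%N by rewrite prednK.
have nM : n%:R <= M.+1%:R :> R by rewrite ler_nat NJ leq_pmull.
have rM : r%:R / M.+1%:R <= r%:R / n%:R :> R by rewrite ler_wpM2l// lef_pV2 ?posrE.
have osc0 := @cell_osc_ge0 R r M L (ltW L0).
have osc1 : 0 <= 1 + 2 * cell_osc r M L by lra.
have oscn : cell_osc r M L <= L * r%:R / n%:R by rewrite /cell_osc -mulrA ler_wpM2l// ltW.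
have zero01 : @unit_cube R r (fun=> 0) by move=> i; rewrite lexx ler01.
have Q0 : 0 <= Q by rewrite addr_ge0 ?p0// !mulr_ge0// ltW.
have n_inv1 : n%:R^-1 <= 1 :> R by rewrite invf_le1//; lra.
have Lr0 : 0 <= L * r%:R by rewrite mulr_ge0// ltW.
have qQ (c : {ffun 'I_r -> 'I_M.+1}) : cell_majorant p L c <= Q.
  have := lipschitz_sup (ltW L0) pL (cell_pt_unit R c) zero01 (d := 1).
  rewrite mulr1 => h; have {h} : `|p (cell_pt R c) - p (fun=> 0)| <= L * r%:R.
    apply: h => i; rewrite subr0; have /andP[u0 u1] := @cell_pt_unit R r M c i.
    by rewrite ger0_norm.
  rewrite ler_norml => /andP[_ h]; rewrite /cell_majorant /Q.
  have : cell_osc r M L <= L * r%:R by apply: (le_trans oscn); rewrite ler_piMr.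
  lra.
have B0 : 0 <= 4 * r%:R :> R by rewrite mulr_ge0.
(* $Nn + 1 \le n^3 + 1 \le 2n^3 \le n^4$, raised to the power [r]. *)
have cB : #|{: {ffun 'I_r -> 'I_M.+2}}|%:R <= expR (4 * r%:R * l) :> R.
  rewrite card_ffun !card_ord natrX -mulrA mulrCA expRM_natl mulrC.
  apply: lerXn2r; rewrite ?nnegrE ?expR_ge0//.
  rewrite mulrC expRM_natl lnK ?posrE// -natrX ler_nat NJ.
  have : (N * n <= n ^ 2 * n)%N by rewrite leq_mul2r Nn orbT.
  rewrite -expnSr => h; rewrite expnS; have w0 : (0 < n ^ 3)%N by rewrite expn_gt0 ltnW.
  by apply: leq_trans (leq_mul n2N (leqnn _)); rewrite mul2n -addnn -addn1 leq_add.
have n0 : (0 < n)%N by exact: ltnW.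
apply: le_trans (expected_ks_bound (ltW L0) p0 p1 pL NJ n0 k0 d01 qQ B0 l1 cB) _.
rewrite lee_fin; apply: sum_rates_le.
- by rewrite addr_ge0.
- by rewrite -[leLHS]sqrtr1 ler_wsqrtr.
- exact: E0.
- exact: exprn_ge0.
(* $(1+x)^n \le e^{nx}$ with $x = 2Lr/n$. *)
- apply: (@le_trans _ _ (expR (2 * (L * r%:R) / n%:R) ^+ n)).
    apply: lerXn2r; rewrite ?nnegrE ?expR_ge0//.
    apply: le_trans (expR_ge1Dx _); rewrite lerD2l -mulrA ler_wpM2l//.
  by rewrite -expRM_natr divfK// gt_eqF.
- exact: sqrtr_ge0.
(* Here [k n >= d1 * E ^+ 2]; the sampling error of the observations, next, uses [n >= E ^+ 2]. *)
- rewrite -sqrtrV ?(ltW d10)// -sqrtrM ?invr_ge0 ?(ltW d10)// ler_pdivlMr//.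
  rewrite -[X in _ * X](gtr0_norm E0) -sqrtr_sqr -sqrtrM; last first.
    by rewrite divr_ge0//; lra.
  apply: ler_wsqrtr; rewrite -mulrA mulrC ler_wpM2r//; first lra.
  by rewrite ler_pdivrMl ?ltr0n// ler_pdivlMr// mulrC -E2.
- rewrite ler_pdivlMr// -[X in _ * X](gtr0_norm E0) -sqrtr_sqr -sqrtrM; last first.
    by rewrite divr_ge0//; lra.
  apply: ler_wsqrtr; rewrite -mulrA ler_piMr//; first lra.
  by rewrite ler_pdivrMl// mulr1.
- exact: d0.
- exact: dE.
- by rewrite mulr_ge0 ?exprn_ge0 ?divr_ge0// ltW.
- by rewrite -mulrA ler_wpM2l// ltW.
- by apply: addr_ge0; [rewrite mulr_ge0 ?divr_ge0|apply: mulr_ge0].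
- apply: (@le_trans _ _ ((Q * r%:R + 2 * (L * r%:R)) / n%:R)).
    rewrite [leRHS]mulrDl; apply: lerD; first by rewrite -mulrA ler_wpM2l.
    by rewrite -mulrA ler_wpM2l.
  apply: ler_wpM2l; first by apply: addr_ge0; apply: mulr_ge0.
  by rewrite lef_pV2 ?posrE.
- exact: sqrtr_ge0.
Qed.
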